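(* Let $\pi\in\mathscr P_\Lambda$ be such that, for all $\mathbf Y'\in\mathbb R^n$ and all $\beta>0$, the mappings $\lambda\mapsto\theta_\lambda(\mathbf Y')f_\lambda(x_i)$, $i=1,\dots,n$, are $\pi$-integrable (here $\theta_\lambda(\mathbf Y')=\theta_\lambda(\beta,\pi,\mathbf Y')$). Assume: (B) There exist i.i.d. random variables $\zeta_1,\dots,\zeta_n$, defined on an enlargement of the underlying probability space, such that (B1) $\xi_1+\zeta_1$ has the same distribution as $(1+1/n)\xi_1$, and (B2) the vectors $(\zeta_1,\dots,\zeta_n)$ and $(\xi_1,\dots,\xi_n)$ are independent. (C) With $L_\zeta(t)=E(e^{t\zeta_1})\in\mathbb R\cup\{\infty\}$, $t\in\mathbb R$, there exist a real number $\beta_0>0$ and, for every $\beta\ge\beta_0$, a functional $\Psi_\beta:\mathscr P'_\Lambda\times\mathscr P'_\Lambda\to\mathbb R$ such that, for every $\beta\ge\beta_0$: $$\exp\Big(\frac{\|f-\bar f_{\mu'}\|_n^2-\|f-\bar f_\mu\|_n^2}{\beta}\Big)\prod_{i=1}^nL_\zeta\Big(\frac{2(\bar f_\mu(x_i)-\bar f_{\mu'}(x_i))}{\beta}\Big)\le\Psi_\beta(\mu,\mu')\quad\text{for all }\mu,\mu'\in\mathscr P'_\Lambda;$$ for every $\mu'\in\mathscr P'_\Lambda$ the map $\mu\mapsto\Psi_\beta(\mu,\mu')$ is concave and continuous in the total variation norm; and $\Psi_\beta(\mu,\mu)=1$ for every $\mu\in\mathscr P'_\Lambda$. Then, for every $\beta\ge\beta_0$,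 the aggregate $\hat f_n$ satisfies $$E\big(\|\hat f_n-f\|_n^2\big)\le\int_\Lambda\|f_\lambda-f\|_n^2\,p(d\lambda)+\frac{\beta\,\mathcal K(p,\pi)}{n+1}\qquad\text{for all }p\in\mathscr P_\Lambda.$$
   Context: Model: $Y_i=f(x_i)+\xi_i$, $i=1,\dots,n$, where $x_1,\dots,x_n$ are non-random elements of a set $\mathcal X$, $f:\mathcal X\to\mathbb R$ is an unknown function, and $\xi_1,\dots,\xi_n$ are i.i.d. zero-mean real random variables. Write $\mathbf Y=(Y_1,\dots,Y_n)$. $(\Lambda,\mathcal A)$ is a measurable space, $\mathscr P_\Lambda$ is the set of all probability measures on it, and $\{f_\lambda,\lambda\in\Lambda\}$ is a given family of (non-random) functions $f_\lambda:\mathcal X\to\mathbb R$ such that $\lambda\mapsto f_\lambda(x)$ is measurable for every $x\in\mathcal X$. $\mathscr P'_\Lambda$ is the set of all $\mu\in\mathscr P_\Lambda$ such that $\lambda\mapsto f_\lambda(x_i)$ is $\mu$-integrable for $i=1,\dots,n$; for $\mu\in\mathscr P'_\Lambda$, $\bar f_\mu(x_i)=\int_\Lambda f_\lambda(x_i)\,\mu(d\lambda)$. Norms: for functions $g,h$ on $\{x_1,\dots,x_n\}$, $\|g-h\|_n^2=\frac1n\sum_{i=1}^n(g(x_i)-h(x_i))^2$; for a vector $\mathbf y\in\mathbb R^n$, $\|\mathbf y-f_\lambda\|_n^2=\frac1n\sum_{i=1}^n(y_i-f_\lambda(x_i))^2$. For a prior $\pi\in\mathscr P_\Lambda$ and $\beta>0$,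 the exponentially weighted aggregate is $$\hat f_n(x)=\int_\Lambda\theta_\lambda(\mathbf Y)f_\lambda(x)\,\pi(d\lambda),\qquad \theta_\lambda(\mathbf y)=\frac{\exp\{-n\|\mathbf y-f_\lambda\|_n^2/\beta\}}{\int_\Lambda\exp\{-n\|\mathbf y-f_w\|_n^2/\beta\}\,\pi(dw)}.$$ $\mathcal K(p,\pi)$ is the Kullback–Leibler divergence, $\mathcal K(p,\pi)=\int\log\frac{dp}{d\pi}\,dp$ if $p\ll\pi$ and $+\infty$ otherwise. *)

(* Defs.v *)
From HB Require Import structures.
From mathcomp Require Import all_boot all_order all_algebra.
From mathcomp Require Import all_classical all_reals all_analysis.

Set Implicit Arguments.
Unset Strict Implicit.
Unset Printing Implicit Defensive.
Import Order.TTheory GRing.Theory Num.Theory.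
Import numFieldNormedType.Exports.

Local Open Scope classical_set_scope.
Local Open Scope ring_scope.

Section random_variables.
Context (R : realType) (d : measure_display) (T : measurableType d).
Implicit Type P : probability T R.

(* Smaller subfamilies are covered by taking A i = setT. *)
Definition mutually_independent P (I : finType) (X : I -> {RV P >-> R}) : Prop :=
  forall A : I -> set R, (forall i, measurable (A i)) ->
    P (\bigcap_i (X i @^-1` A i)) = (\prod_i P (X i @^-1` A i))%E.

Definition same_law P (X Y : T -> R) : Prop :=
  forall A : set R, measurable A -> P (X @^-1` A) = P (Y @^-1` A).

Definition iid P (I : finType) (X : I -> {RV P >-> R}) : Prop :=
  mutually_independent X /\ forall i j, same_law P (X i) (X j).

(* n.-tuple R carries the product of the Borel sigma-algebras. *)
Definition independent_vectors P (n : nat) (X Y : 'I_n -> T -> R) : Prop :=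
  forall A B : set (n.-tuple R), measurable A -> measurable B ->
    let VX := (fun w => [tuple X i w | i < n]) in
    let VY := (fun w => [tuple Y i w | i < n]) in
    P ((VX @^-1` A) `&` (VY @^-1` B)) = (P (VX @^-1` A) * P (VY @^-1` B))%E.

(* The probability space (T', P') enlarges (T, P) through the projection e: a
   random variable X on T is identified with X \o e on T'. *)
Definition enlargement P (d' : measure_display) (T' : measurableType d')
    (P' : probability T' R) (e : {mfun T' >-> T}) : Prop :=
  forall A : set T, measurable A -> P' (e @^-1` A) = P A.

End random_variables.

Section probability_measures.
Context (R : realType) (d : measure_display) (L : measurableType d).
Implicit Types mu nu p pi : probability L R.

(* The Radon-Nikodym derivative is finite everywhere, and p-almost everywhere
   positive, so that neither [fine] nor the convention ln 0 = 0 matters. *)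
Definition KL p pi : \bar R :=
  if `[< p `<< pi >] then
    (\int[p]_l
      (ln (fine (Radon_Nikodym (charge_of_finite_measure p) pi l)))%:E)%E
  else +oo%E.

Definition mixture (a : {i01 R}) mu nu : set L -> \bar R :=
  measure_add (mscale a%:num%:nng mu) (mscale (1 - a%:num)%:nng nu).

HB.instance Definition _ a mu nu := Measure.on (mixture a mu nu).

Lemma mixtureE a mu nu A :
  mixture a mu nu A = (a%:num%:E * mu A + (1 - a%:num)%:E * nu A)%E.
Proof. by rewrite /mixture measure_addE. Qed.

Lemma mixture_setT a mu nu : mixture a mu nu setT = 1%E.
Proof.
by rewrite mixtureE !probability_setT !mule1 -EFinD addrC subrK.
Qed.

HB.instance Definition _ a mu nu :=
  Measure_isProbability.Build _ _ _ (mixture a mu nu) (mixture_setT a mu nu).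

Definition concave_on (D : set (probability L R)) (G : probability L R -> R) :=
  forall (a : {i01 R}) mu nu, D mu -> D nu ->
    a%:num * G mu + (1 - a%:num) * G nu <= G (mixture a mu nu).

(* |m|(L) for a finite signed measure m: finite disjoint families give the same
   supremum as finite measurable partitions. *)
Definition total_variation_norm (m : set L -> \bar R) : \bar R :=
  ereal_sup [set s | exists k, exists A : 'I_k -> set L,
    [/\ forall i, measurable (A i), trivIset setT A &
        s = (\sum_(i < k) `|m (A i)|)%E]].

Definition tv_continuous_on (D : set (probability L R))
    (G : probability L R -> R) :=
  forall mu, D mu -> forall eps : R, 0 < eps ->
    exists2 delta : R, 0 < delta &
      forall nu, D nu ->
        (total_variation_norm (fun A => (nu A - mu A)%E) < delta%:E)%E ->
        `|G nu - G mu| < eps.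

End probability_measures.

Section aggregation.
Context (R : realType) (X : Type) (n : nat) (x : 'I_n -> X).
Context (d : measure_display) (L : measurableType d) (F : L -> X -> R).
Implicit Types (mu pi : probability L R) (y : 'I_n -> R).

Definition sqnorm_n y : R := n%:R^-1 * \sum_(i < n) y i ^+ 2.

Definition sqdist_n (g h : X -> R) : R := sqnorm_n (fun i => g (x i) - h (x i)).

Definition admissible mu : Prop :=
  forall i, mu.-integrable setT (fun l => (F l (x i))%:E).

(* Like [ewa] below, only meaningful where the integrand is integrable. *)
Definition fbar mu (z : X) : R := \int[mu]_l F l z.

Definition gibbs beta y l : R :=
  expR (- (n%:R * sqnorm_n (fun i => y i - F l (x i)) / beta)).

Definition theta beta pi y l : R :=
  gibbs beta y l / \int[pi]_w gibbs beta y w.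

Definition ewa beta pi y (z : X) : R :=
  \int[pi]_l (theta beta pi y l * F l z).

End aggregation.

(* Main.v *)
(** For a noise vector t and a > 0 put
      Z a t = int exp (- (a sum_i r_i^2 + 2 sum_i t_i r_i) / beta) dpi,
    where r_i = f (x_i) - F l (x_i), so that the aggregate is the mean of F l
    under the Gibbs measure mu' whose partition function is Z 1 xi. Put
    k = 1 + 1/n. Completing the square and ln N <= N - 1 give, for all xi, zeta,
      ln (Z k (xi + zeta)) <= ln (Z 1 xi) - |fhat - f|_n^2 / beta
                              + (linear in zeta) + N - 1,
    where the mean of N in zeta is the integral over mu' of the left-hand side
    of (C) at (dirac l, mu'). Averages of F l over the cells of finer and finer
    partitions, concavity of Psi and Fatou's lemma bound that mean by
    Psi (mu', mu') = 1. By (B), xi + zeta has the law of k xi, and Lyapunov's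
    inequality reads k ln (Z 1 xi) <= ln (Z k (k xi)); hence the expected risk is
    at most - beta / (n + 1) E (ln (Z k (k xi))), which the Donsker-Varadhan
    inequality bounds by the right-hand side of the theorem. No second moment of
    xi is available, so the integrability of ln (Z k (k xi)) is itself deduced,
    by truncation, from the same comparison of laws. *)

From HB Require Import structures.
Require Import Defs.
From mathcomp Require Import all_boot all_order all_algebra.
From mathcomp Require Import all_classical all_reals all_analysis.
From mathcomp Require Import measurable_realfun ring lra.

Set Implicit Arguments.
Unset Strict Implicit.
Unset Printing Implicit Defensive.
Import Order.TTheory GRing.Theory Num.Theory.
Import numFieldNormedType.Exports.

Local Open Scope classical_set_scope.
Local Open Scope ring_scope.

(** * Densities *)

(** With Y_i = f (x_i) + xi_i, the square |Y - F l|^2 is a sum of (r_i + xi_i)^2. Its part in xi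
    alone cancels in the Gibbs weights, and the rest is the exponent of Z 1 xi. The integrand of (C)
    carries r^2 with weight 1/n and is linear in zeta, so it moves (1, xi) to (k, xi + zeta).
    Scaling the quadratic weight and the noise together by k multiplies the exponent by k, which is
    why the same k in (B) makes Z 1 xi comparable with Z k (k xi).

    Two obstacles shape the proof. (C) is wanted in integrated form over Dirac masses, but Psi
    (dirac l, mu') is not assumed measurable in l, and distinct Dirac masses are far apart in total
    variation. Hence only the left-hand side of (C) is passed to the limit: it depends on finitely
    many means and is lower semicontinuous in them.

    The second is that ln (Z k (k xi)) has an affine minorant in the noise, but only a quadratic
    majorant is at hand. The comparison of laws bounds its mean by 1/k < 1 times itself; applied to
    truncations, this contraction controls the positive part by the negative one. *)

Lemma le_ge0_integral d (T : measurableType d) (R : realType)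
    (mu : {measure set T -> \bar R}) (f g : T -> \bar R) :
  (forall t, (0 <= f t)%E) -> (forall t, (f t <= g t)%E) ->
  (\int[mu]_t f t <= \int[mu]_t g t)%E.
Proof.
(* The integral of a nonnegative function is a supremum over simple functions below it, so neither
   function has to be measurable. This admits integrands such as the risk of the aggregate, whose
   measurability is never established. *)
move=> f0 fg; rewrite !ge0_integralTE//; last first.
  by move=> t; exact: le_trans (fg t).
apply: ge_ereal_sup => _ [h hf <-]; apply: ereal_sup_ubound => /=.
by exists h => // t; exact: le_trans (fg t).
Qed.

Section density.
Local Open Scope ereal_scope.
Context d (T : measurableType d) (R : realType).
Variables (mu : {measure set T -> \bar R}) (g : T -> R).
Hypotheses (g0 : forall t, (0 <= g t)%R) (mg : measurable_fun setT g).

(** The two proofs are arguments so that the measure structure can be inferred from the term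
    itself. *)
Definition density (g0 : forall t, (0 <= g t)%R) (mg : measurable_fun setT g)
  (A : set T) : \bar R := \int[mu]_(t in A) (g t)%:E.

Local Notation nu := (density g0 mg).

Let nu0 : nu set0 = 0.
Proof. by rewrite /density integral_set0. Qed.

Let nu_ge0 A : 0 <= nu A.
Proof. by apply: integral_ge0 => t _; rewrite lee_fin. Qed.

Let nu_sigma_additive : semi_sigma_additive nu.
Proof.
apply: semi_sigma_additive_nng_induced; first exact/measurable_EFinP.
by move=> t; rewrite lee_fin.
Qed.

HB.instance Definition _ :=
  isMeasure.Build _ _ _ nu nu0 nu_ge0 nu_sigma_additive.

Import HBNNSimple.

Lemma ge0_integral_density (f : T -> \bar R) :
  measurable_fun setT f -> (forall t, 0 <= f t) ->
  \int[nu]_t f t = \int[mu]_t (f t * (g t)%:E).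
Proof.
move=> mf f0.
have mgE : measurable_fun setT (EFin \o g) by exact/measurable_EFinP.
pose h := nnsfun_approx measurableT mf.
have hf t : (EFin \o h n) t @[n --> \oo] --> f t by exact: cvg_nnsfun_approx.
have nd_h t m n : (m <= n)%N -> (EFin \o h m) t <= (EFin \o h n) t.
  by move=> mn; rewrite lee_fin; exact/lefP/nd_nnsfun_approx.
have := @cvg_monotone_convergence _ _ _ nu _ measurableT (fun n => EFin \o h n).
move=> /(_ _ _ (fun t _ => nd_h t)) c1.
have := @cvg_monotone_convergence _ _ _ mu _ measurableT
  (fun n => (EFin \o h n) \* (EFin \o g)).
move=> c2.
have l1 : \int[nu]_t (EFin \o h n) t @[n --> \oo] --> \int[nu]_t f t.
  rewrite (_ : \int[nu]_t f t = \int[nu]_t lim ((EFin \o h n) t @[n --> \oo])).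
    by apply: c1 => [n|n t _]; [exact/measurable_EFinP|rewrite lee_fin].
  by apply: eq_integral => t _; apply/esym/cvg_lim.
have l2 : \int[mu]_t ((EFin \o h n) t * (g t)%:E) @[n --> \oo] -->
    \int[mu]_t (f t * (g t)%:E).
  rewrite (_ : \int[mu]_t (f t * (g t)%:E) = \int[mu]_t
      lim (((EFin \o h n) \* (EFin \o g)) t @[n --> \oo])).
    apply: c2 => [n|n t _|t _ m n mn].
    - by apply: emeasurable_funM => //; exact/measurable_EFinP.
    - by rewrite mule_ge0// lee_fin.
    - by rewrite lee_wpmul2r ?lee_fin//; exact/lefP/nd_nnsfun_approx.
  by apply: eq_integral => t _; apply/esym/cvg_lim => //; exact: cvgeZr.
suff E n : \int[nu]_t (EFin \o h n) t = \int[mu]_t ((EFin \o h n) t * (g t)%:E).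
  move: l1; under eq_fun do rewrite E.
  by move=> l1; exact: (cvg_unique _ l1 l2).
have hE t : (h n t)%:E =
    \sum_(y \in range (h n)) (y * \1_(h n @^-1` [set y]) t)%:E.
  by rewrite [in LHS]fimfunE fsumEFin.
transitivity (\int[nu]_t
    (\sum_(y \in range (h n)) (y * \1_(h n @^-1` [set y]) t)%:E)).
  by apply: eq_integral => t _; rewrite -hE.
transitivity (\int[mu]_t
    (\sum_(y \in range (h n)) (y * \1_(h n @^-1` [set y]) t)%:E * (g t)%:E));
    last first.
  apply: eq_integral => t _; rewrite /= hE -ge0_mule_fsuml// => y.
  exact: nnfun_muleindic_ge0.
have mi y : measurable_fun setT
    (fun t => (y * \1_(h n @^-1` [set y]) t)%:E : \bar R).
  by apply/measurable_EFinP; exact: measurable_funM.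
rewrite ge0_integral_fsum//; last first.
  by move=> y t _; exact: nnfun_muleindic_ge0.
rewrite [RHS]ge0_integral_fsum//; last 2 first.
- move=> y; exact: emeasurable_funM.
- by move=> y t _; rewrite mule_ge0 ?nnfun_muleindic_ge0// lee_fin.
apply: eq_fsbigr => y /[!inE] -[t0 _ <-{y}].
have yg0 : (0 <= h n t0)%R by [].
have mA : measurable (h n @^-1` [set h n t0]) by exact: measurable_sfunP.
under eq_integral do rewrite EFinM.
under [RHS]eq_integral do rewrite EFinM -muleA.
have m1 : measurable_fun setT
    (fun t => (\1_(h n @^-1` [set h n t0]) t)%:E : \bar R).
  by apply/measurable_EFinP; exact: measurable_indic.
rewrite ge0_integralZl//.
rewrite [RHS]ge0_integralZl//; last 2 first.
- exact: emeasurable_funM.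
- by move=> t _; rewrite mule_ge0// lee_fin.
congr (_ * _); rewrite integral_indic// setIT /= /density integral_mkcond.
by apply: eq_integral => t _; rewrite epatch_indic muleC.
Qed.

End density.

(** * Independence and the law of the noise *)

Lemma prod_fin_num (R : realType) (I : Type) (s : seq I) (Q : pred I)
    (a : I -> \bar R) :
  (forall i, Q i -> a i \is a fin_num) ->
  (\prod_(i <- s | Q i) a i)%E \is a fin_num.
Proof.
move=> fa; apply: (big_ind (fun x : \bar R => x \is a fin_num)) => // x y fx fy.
by rewrite fin_numM.
Qed.

Section independence.
Context d (T : measurableType d) (R : realType) (P : probability T R).
Context (I : finType) (X : I -> {RV P >-> R}).
Hypothesis indX : mutually_independent X.

(** For indicators this is the definition of independence; general factors are then restored one
    index at a time, by induction on the list of indices whose factor may differ from an indicator.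
    Finite means keep the product of the other factors a real constant, which can scale a
    measure. *)
Lemma expectation_prod_indep (h : I -> R -> R) :
  (forall i, measurable_fun setT (h i)) -> (forall i r, 0 <= h i r) ->
  (forall i, \int[P]_w (h i (X i w))%:E < +oo)%E ->
  (\int[P]_w (\prod_i h i (X i w))%:E = \prod_i \int[P]_w (h i (X i w))%:E)%E.
Proof.
suff main (s : seq I) : forall h : I -> R -> R, (forall i, measurable_fun setT (h i)) ->
    (forall i r, 0 <= h i r) ->
    (forall i, \int[P]_w (h i (X i w))%:E < +oo)%E ->
    (forall i, i \notin s -> exists2 A, measurable A & h i = \1_A) ->
  (\int[P]_w (\prod_i h i (X i w))%:E = \prod_i \int[P]_w (h i (X i w))%:E)%E.
  move=> mh h0 hoo; have := main (enum I) h mh h0 hoo; apply => i.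
  by rewrite mem_enum.
elim: s => [|a s IH] {}h mh h0 hoo hA.
  have /choice[A AP] : forall i, exists A, measurable A /\ h i = \1_A.
    by move=> i; have [//|A mA hi] := hA i; exists A.
  have mA i : measurable (A i) by have [] := AP i.
  have hE i : h i = \1_(A i) by have [] := AP i.
  transitivity (P (\bigcap_i (X i @^-1` A i))).
    rewrite -[in RHS](setIT (\bigcap_i _)) -integral_indic//; last first.
      apply: fin_bigcap_measurable => // i _.
      exact: measurable_funPTI.
    apply: eq_integral => w _; congr EFin; rewrite indicE.
    have [/set_mem wA|/negP wA] := boolP (w \in _).
      by rewrite big1// => i _; rewrite hE indicE mem_set//; exact: wA.
    have [i wAi] : exists i, ~ A i (X i w).
      by apply/existsNP => wAi; apply: wA; apply/mem_set => i _; exact: wAi.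
    by rewrite (bigD1 i)//= hE indicE memNset// mul0r.
  rewrite indX//; apply: eq_bigr => i _.
  rewrite hE -[in LHS](setIT (X i @^-1` _)) -integral_indic//.
  exact: measurable_funPTI.
pose H w := \prod_(i | i != a) h i (X i w).
have mhX i : measurable_fun setT (fun w => h i (X i w)).
  by apply: measurableT_comp.
have H0 w : 0 <= H w by exact: prodr_ge0.
have mH : measurable_fun setT H.
  rewrite /H; under eq_fun do rewrite big_mkcond/=.
  by apply: measurable_prod => i _; case: (i != a).
have I0 i : (0 <= \int[P]_w (h i (X i w))%:E)%E.
  by apply: integral_ge0 => w _; rewrite lee_fin.
pose c := (\prod_(i | i != a) \int[P]_w (h i (X i w))%:E)%E.
have c0 : (0 <= c)%E by apply: prode_ge0.
have cfin : c \is a fin_num.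
  by apply: prod_fin_num => i _; rewrite ge0_fin_numE.
have C0 : 0 <= fine c by exact: fine_ge0.
(* With an indicator at [a], the induction hypothesis says that the law of [X a] under the density
   [H] is [c] times its law under [P]. Integrating [h a] against both measures gives the claim. *)
have key A : measurable A ->
    pushforward (density P H0 mH) (X a) A =
    mscale (NngNum C0) (distribution P (X a)) A.
  move=> mA; rewrite /mscale/= /pushforward/= fineK//.
  pose h' i := if i == a then \1_A else h i.
  have mXA : measurable (X a @^-1` A).
    exact: measurable_funPTI.
  have h'a w : h' a (X a w) = \1_(X a @^-1` A) w.
    by rewrite /h' eqxx !indicE.
  have h'N i : i != a -> h' i = h i by rewrite /h' => /negPf ->.
  have h'aoo : (\int[P]_w (h' a (X a w))%:E = P (X a @^-1` A))%E.
    under eq_integral do rewrite h'a.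
    by rewrite integral_indic// setIT.
  have := IH h'; rewrite (bigD1 a)//= h'aoo.
  under eq_bigr => i /h'N -> do over.
  rewrite -/c muleC => <-//.
  - rewrite /density integral_mkcond; apply: eq_integral => w _.
    rewrite (bigD1 a)//= h'a epatch_indic EFinM muleC.
    by congr (_ * (_)%:E)%E; apply: eq_bigr => i /h'N ->.
  - move=> i; rewrite /h'; case: ifP => // _; exact: measurable_indic.
  - by move=> i r; rewrite /h'; case: ifP => // _; rewrite indicE.
  - move=> i; have [->|/h'N ->//] := eqVneq i a.
    by rewrite h'aoo; rewrite (le_lt_trans (probability_le1 P mXA))// ltry.
  - move=> i ins; have [->|ia] := eqVneq i a; first by exists A; rewrite ?/h' ?eqxx.
    rewrite h'N//; apply: hA; rewrite inE negb_or ia; exact: ins.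
rewrite [RHS](bigD1 a)//= -/c.
have mha : measurable_fun setT (fun r => (h a r)%:E) by exact/measurable_EFinP.
have ha0 r : (0 <= (h a r)%:E)%E by rewrite lee_fin.
transitivity (\int[density P H0 mH]_w (h a (X a w))%:E)%E.
  rewrite ge0_integral_density//; last exact/measurable_EFinP.
  by apply: eq_integral => w _; rewrite (bigD1 a)//= EFinM.
transitivity (\int[pushforward (density P H0 mH) (X a)]_r (h a r)%:E)%E.
  by rewrite ge0_integral_pushforward.
rewrite (eq_measure_integral (mscale (NngNum C0) (distribution P (X a)))).
  rewrite ge0_integral_mscale//= fineK// muleC.
  by rewrite ge0_integral_distribution.
by move=> A mA _; exact: key.
Qed.

End independence.

Section tuple_boxes.
Context (R : realType) (n : nat).
Implicit Types A : 'I_n -> set R.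

Definition box A : set (n.-tuple R) := [set t | forall i, A i (tnth t i)].

Lemma measurable_box A : (forall i, measurable (A i)) -> measurable (box A).
Proof.
move=> mA; rewrite (_ : box A = \bigcap_i ((@tnth n R ^~ i) @^-1` A i)).
  apply: fin_bigcap_measurable => // i _; rewrite -[X in measurable X]setTI.
  exact: measurable_tnth.
by apply/seteqP; split=> [t At i _|t At i]; [exact: At|exact: (At i)].
Qed.

(** Boxes are stable under intersection, include the whole space and generate the sigma-algebra of
    tuples, since a one-coordinate cylinder is a box whose other sides are [setT]. *)
Lemma measure_tuple_unique (m1 m2 : {measure set (n.-tuple R) -> \bar R}) :
  (m1 setT < +oo)%E ->
  (forall A, (forall i, measurable (A i)) -> m1 (box A) = m2 (box A)) ->
  forall B, measurable B -> m1 B = m2 B.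
Proof.
move=> m1T m12 B mB.
pose G := [set box A | A in [set A | forall i, measurable (A i)]].
apply: (measure_unique G (fun=> setT)) => //.
- apply/seteqP; split.
    apply: smallest_sub; first exact: smallest_sigma_algebra.
    rewrite -bigcup_seq => C [i _ [A mA <-]]; apply: sub_sigma_algebra.
    exists (fun j => if j == i then A else setT).
      by move=> j; case: (j == i).
    apply/seteqP; split=> [t /(_ i)|t [_ At] j]; first by rewrite eqxx.
    by case: eqP => // ->.
  apply: smallest_sub; first exact: sigma_algebra_measurable.
  by move=> _ [A mA <-]; exact: measurable_box.
- move=> _ _ [A1 mA1 <-] [A2 mA2 <-]; exists (fun i => A1 i `&` A2 i).
    by move=> i; exact: measurableI.
  apply/seteqP; split=> [t At|t [A1t A2t] i].
    by split=> i; have [] := At i.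
  by split; [exact: A1t|exact: A2t].
- by move=> _; exists (fun=> setT) => //; apply/seteqP; split.
- by apply/seteqP; split => // t _; exists 0%N.
- by move=> _ [A mA <-]; exact: m12.
Qed.

End tuple_boxes.

Section noise_law.
Context (R : realType) (d : measure_display) (Omega : measurableType d).
Context (P : probability Omega R) (n : nat) (n_gt0 : (0 < n)%N).
Context (xi : 'I_n -> {RV P >-> R}).
Context (d' : measure_display) (Omega' : measurableType d').
Context (P' : probability Omega' R) (e : {mfun Omega' >-> Omega}).
Context (zeta : 'I_n -> {RV P' >-> R}) (k : R).
Hypotheses (xi_iid : iid xi) (zeta_iid : iid zeta).
Hypothesis enl : enlargement P P' e.
Let i1 := Ordinal n_gt0.
Hypothesis B1 : same_law P' (fun w => xi i1 (e w) + zeta i1 w)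
                            (fun w => k * xi i1 (e w)).
Hypothesis B2 : independent_vectors P' zeta (fun i => xi i \o e).

Let add_set (A : set R) : set (R * R) := [set u | A (u.1 + u.2)].

Let measurable_add_set A : measurable A -> measurable (add_set A).
Proof.
move=> mA; rewrite -[add_set A]setTI.
have : measurable_fun setT (fun u : R * R => u.1 + u.2).
  exact: measurable_funD.
by move=> /(_ measurableT A mA).
Qed.

Let xsection_add A r : xsection (add_set A) r = [set z | A (r + z)].
Proof.
by apply/seteqP; split=> z; [move/xsectionP|move=> Arz; apply/xsectionP].
Qed.

(** The left-hand side is the mass of [add_set A] under the product of the laws of [xi i1] and
    [zeta i1]. By (B2), read on cylinders, that product is the joint law of [xi i1 \o e] and
    [zeta i1], so (B1) applies; equal laws carry the result to every [i]. *)
Lemma integral_shift_law (A : set R) i : measurable A ->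
  (\int[P]_w P' (zeta i @^-1` [set z | A (xi i w + z)%R]) =
   P (xi i @^-1` [set r | A (k * r)%R]))%E.
Proof.
move=> mA.
have mkA : measurable [set r : R | A (k * r)%R].
  rewrite -[X in measurable X]setTI.
  by have := @mulrl_measurable R setT k measurableT A mA.
have mAz r : measurable [set z : R | A (r + z)].
  by rewrite -xsection_add; apply: measurable_xsection; exact: measurable_add_set.
transitivity (\int[distribution P (xi i)]_r
    distribution P' (zeta i1) (xsection (add_set A) r))%E.
  rewrite ge0_integral_distribution//; last first.
    by apply: measurable_fun_xsection; exact: measurable_add_set.
  apply: eq_integral => w _ /=; rewrite xsection_add /distribution /pushforward.
  exact: (zeta_iid.2 i i1).
rewrite (eq_measure_integral (distribution P (xi i1))); last first.
  by move=> B mB _; apply: (xi_iid.2 _ _).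
rewrite -[LHS]/((distribution P (xi i1) \x distribution P' (zeta i1))%E
  (add_set A)).
have mpair : measurable_fun setT (fun w => (xi i1 (e w), zeta i1 w)).
  by apply/measurable_fun_pair => //; exact: measurableT_comp.
rewrite (@product_measure_unique _ _ _ _ _ _ _
  (pushforward P' (fun w => (xi i1 (e w), zeta i1 w))))//; first last.
- exact: measurable_add_set.
- move=> B C mB mC.
  have mt (D : set R) : measurable D ->
      measurable [set t : n.-tuple R | D (tnth t i1)].
    by move=> mD; rewrite -[X in measurable X]setTI; exact: measurable_tnth.
  have := B2 (mt _ mC) (mt _ mB); rewrite /pushforward/= => BC.
  rewrite [RHS]muleC; transitivity (P' (zeta i1 @^-1` C) *
      P' ((xi i1 \o e) @^-1` B))%E.
    rewrite (_ : zeta i1 @^-1` C = [set w | C (zeta i1 w)])//.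
    rewrite (_ : _ @^-1` B = [set w | B (xi i1 (e w))])//.
    move: BC; rewrite !/(_ @^-1` _)/=.
    under eq_set do rewrite tnth_mktuple.
    under [in X in _ `&` X]eq_set do rewrite tnth_mktuple.
    under [in X in (_ = _ * X)%E]eq_set do rewrite tnth_mktuple.
    move=> <-; congr (P' _); apply/seteqP.
    by split=> w [] /=.
  congr (_ * _)%E; rewrite -[LHS]/(P' (e @^-1` (xi i1 @^-1` B))) enl//.
  exact: measurable_funPTI.
rewrite -[LHS]/(P' ((fun w => xi i1 (e w) + zeta i1 w) @^-1` A)).
rewrite B1// -[LHS]/(P' (e @^-1` (xi i1 @^-1` [set r | A (k * r)%R]))) enl.
  by apply: (xi_iid.2 _ _).
exact: measurable_funPTI.
Qed.

Let S (u : Omega * Omega') : n.-tuple R := [tuple xi i u.1 + zeta i u.2 | i < n].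

Let K (w : Omega) : n.-tuple R := [tuple k * xi i w | i < n].

Lemma measurable_sum_noise : measurable_fun setT S.
Proof.
apply/measurable_fun_tnthP => i.
rewrite (_ : _ \o _ = (fun u => xi i u.1 + zeta i u.2)).
  by apply: measurable_funD; apply: measurableT_comp.
by apply/funext => u /=; rewrite tnth_mktuple.
Qed.

Lemma measurable_scaled_noise : measurable_fun setT K.
Proof.
apply/measurable_fun_tnthP => i.
rewrite (_ : _ \o _ = (fun w => k * xi i w)); first exact: measurable_funM.
by apply/funext => u /=; rewrite tnth_mktuple.
Qed.

(** [S] lives on a fresh product of [P] and [P'], where the two noises are independent by
    construction, so that Fubini is available and (B) enters one coordinate at a time. On boxes,
    independence over the coordinates, of [zeta] and then of [xi], reduces both laws to products of
    the one-dimensional identity. *)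
Lemma sum_noise_law B : measurable B ->
  pushforward (P \x P')%E S B = pushforward P K B.
Proof.
apply: measure_tuple_unique.
- exact: measurable_sum_noise.
- exact: measurable_scaled_noise.
- move=> mS; rewrite -[ltLHS]/((P \x P')%E setT).
  rewrite -setXTT product_measure1E//.
  by apply: lte_mul_pinfty; rewrite ?fin_num_measure// -ge0_fin_numE// fin_num_measure.
move=> mS mK A mA; rewrite /pushforward/=.
pose q i r := fine (P' (zeta i @^-1` [set z | A i (r + z)])).
have mAz i r : measurable [set z : R | A i (r + z)].
  by rewrite -xsection_add; apply: measurable_xsection; exact: measurable_add_set.
have mq i : measurable_fun setT (q i).
  apply: measurableT_comp => //.
  rewrite (_ : (fun _ => _) =
      (fun r => distribution P' (zeta i) (xsection (add_set (A i)) r))).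
    by apply: measurable_fun_xsection; exact: measurable_add_set.
  by apply/funext => r; rewrite xsection_add.
have qE i r : (q i r)%:E = P' (zeta i @^-1` [set z | A i (r + z)]).
  by rewrite fineK// fin_num_measure//; exact: measurable_funPTI.
have q0 i r : 0 <= q i r by exact: fine_ge0.
have intq i : (\int[P]_w (q i (xi i w))%:E =
    P (xi i @^-1` [set r | A i (k * r)%R]))%E.
  by rewrite -integral_shift_law//; apply: eq_integral => w _; rewrite qE.
have mkA i : measurable [set r : R | A i (k * r)%R].
  rewrite -[X in measurable X]setTI.
  by have := @mulrl_measurable R setT k measurableT _ (mA i).
rewrite /product_measure1.
transitivity (\int[P]_w (\prod_i q i (xi i w))%:E)%E.
  apply: eq_integral => w _ /=.
  rewrite -prodEFin (eq_bigr _ (fun i _ => qE i (xi i w))).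
  rewrite -(zeta_iid.1)//; congr (P' _); apply/seteqP; split.
    by move=> w' /xsectionP/= h i _; have := h i; rewrite tnth_mktuple.
  by move=> w' h; apply/xsectionP => i; rewrite tnth_mktuple; exact: h.
rewrite expectation_prod_indep//; last 2 first.
- exact: xi_iid.1.
- move=> i; rewrite intq (le_lt_trans (probability_le1 P _)) ?ltry//.
  exact: measurable_funPTI.
rewrite (eq_bigr _ (fun i _ => intq i)) -(xi_iid.1)//; congr (P _).
apply/seteqP; split=> w h i; first by rewrite tnth_mktuple; exact: h.
by move=> _; have := h i; rewrite tnth_mktuple.
Qed.

End noise_law.

(** * Reweighted and conditional probabilities *)

Section tilt.
Context d (T : measurableType d) (R : realType) (mu : probability T R).
Variables (g : T -> R).
Hypotheses (g0 : forall t, 0 <= g t) (mg : measurable_fun setT g).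

(** [mnormalize] falls back to [mu] when the total mass of the density is zero or infinite, so this
    is always a probability; the lemmas below exclude that case by a positive real mass [Z]. *)
Definition tilt (g0 : forall t, 0 <= g t) (mg : measurable_fun setT g) :
  probability T R := mnormalize (density mu g0 mg) mu.

Local Notation nu := (tilt g0 mg).

Variable Z : R.
Hypotheses (Z_gt0 : 0 < Z) (intg : (\int[mu]_t (g t)%:E = Z%:E)%E).

Let Zi_ge0 : 0 <= Z^-1. Proof. by rewrite invr_ge0 ltW. Qed.

Lemma tiltE A : nu A = ((Z^-1)%:E * \int[mu]_(t in A) (g t)%:E)%E.
Proof.
rewrite /tilt/= /mnormalize/= /density intg.
case: ifPn => [/orP[|//]|_]; last by rewrite muleC.
by rewrite eqe gt_eqF.
Qed.

Lemma ge0_integral_tilt (f : T -> \bar R) :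
  measurable_fun setT f -> (forall t, 0 <= f t)%E ->
  (\int[nu]_t f t = (Z^-1)%:E * \int[mu]_t (f t * (g t)%:E))%E.
Proof.
move=> mf f0.
rewrite (eq_measure_integral (mscale (NngNum Zi_ge0) (density mu g0 mg))).
  by rewrite ge0_integral_mscale// ge0_integral_density.
by move=> A mA _; exact: tiltE.
Qed.

Lemma integrable_tilt (f : T -> R) : measurable_fun setT f ->
  mu.-integrable setT (fun t => (f t * g t)%:E) ->
  nu.-integrable setT (EFin \o f).
Proof.
move=> mf /integrableP[_ fgoo]; apply/integrableP; split.
  exact/measurable_EFinP.
rewrite ge0_integral_tilt//; last first.
  by apply: measurableT_comp => //; exact/measurable_EFinP.
rewrite lte_mul_pinfty ?lee_fin//.
rewrite (le_lt_trans _ fgoo)// le_eqVlt; apply/orP; left; apply/eqP.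
by apply: eq_integral => t _; rewrite /= normrM (ger0_norm (g0 t)).
Qed.

Lemma Rintegral_tilt (f : T -> R) : measurable_fun setT f ->
  mu.-integrable setT (fun t => (f t * g t)%:E) ->
  \int[nu]_t f t = Z^-1 * \int[mu]_t (f t * g t).
Proof.
move=> mf intfg.
have mfE : measurable_fun setT (EFin \o f) by exact/measurable_EFinP.
rewrite /Rintegral -[RHS]/(fine (Z^-1 * _)%:E); congr fine.
rewrite EFinM fineK ?integrable_fin_num// integralE [in RHS]integralE.
have gf t : (g t)%:E \is a fin_num by [].
have gE0 t : (0 <= (g t)%:E)%E by rewrite lee_fin.
rewrite (ge0_integral_tilt (measurable_funepos mfE)); last first.
  by move=> t; exact: funepos_ge0.
rewrite (ge0_integral_tilt (measurable_funeneg mfE)); last first.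
  by move=> t; exact: funeneg_ge0.
set h := fun t => (f t * g t)%:E.
have pE t : (((EFin \o f)^\+ t * (g t)%:E)%E = h^\+ t)%E.
  by rewrite !funeposE maxe_pMl// mul0e -EFinM.
have nE t : (((EFin \o f)^\- t * (g t)%:E)%E = h^\- t)%E.
  by rewrite !funenegE maxe_pMl// mul0e /= -EFinM mulNr.
rewrite (eq_integral _ _ (fun t _ => pE t)) (eq_integral _ _ (fun t _ => nE t)).
rewrite -muleBr// fin_num_adde_defr//.
exact: integrable_pos_fin_num.
Qed.

End tilt.

Section conditioning.
Context d (T : measurableType d) (R : realType) (m : probability T R).
Implicit Types A B : set T.

Lemma indic_ge0 A t : 0 <= \1_A t :> R.
Proof. by rewrite indicE. Qed.

(* [m] itself when [A] is not measurable or is negligible. *)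
Definition conditional A : probability T R :=
  match pselect (measurable A) with
  | left mA => tilt m (indic_ge0 A) (measurable_indic mA)
  | right _ => m
  end.

Variable A : set T.
Hypotheses (mA : measurable A) (A_gt0 : (0 < m A)%E).

Let Z_gt0 : 0 < fine (m A).
Proof. by rewrite fine_gt0// A_gt0/= -ge0_fin_numE// fin_num_measure. Qed.

Let intA : (\int[m]_t (\1_A t)%:E = (fine (m A))%:E)%E.
Proof. by rewrite integral_indic// setIT fineK// fin_num_measure. Qed.

Lemma conditionalE B : measurable B ->
  (conditional A B = ((fine (m A))^-1)%:E * m (B `&` A))%E.
Proof.
move=> mB; rewrite /conditional; case: pselect => // mA'.
by rewrite (tiltE _ _ Z_gt0 intA) integral_indic// setIC.
Qed.

Lemma integrable_mul_indic (f : T -> R) : m.-integrable setT (EFin \o f) ->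
  m.-integrable setT (fun t => (f t * \1_A t)%:E).
Proof.
move=> intf.
have := (integrable_restrict m mA measurableT (EFin \o f)).1.
rewrite setTI => /(_ (integrableS measurableT mA (@subsetT _ _) intf)).
by apply: eq_integrable => // t _; rewrite epatch_indic EFinM.
Qed.

Lemma integrable_conditional (f : T -> R) : m.-integrable setT (EFin \o f) ->
  (conditional A).-integrable setT (EFin \o f).
Proof.
move=> intf; rewrite /conditional; case: pselect => // mA'.
apply: (integrable_tilt _ _ Z_gt0 intA); last exact: integrable_mul_indic.
by apply/measurable_EFinP; exact: measurable_int intf.
Qed.

Lemma Rintegral_conditional (f : T -> R) : m.-integrable setT (EFin \o f) ->
  \int[conditional A]_t f t = (fine (m A))^-1 * \int[m]_t (f t * \1_A t).
Proof.
move=> intf; rewrite /conditional; case: pselect => // mA'.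
rewrite (Rintegral_tilt _ _ Z_gt0 intA)//; last exact: integrable_mul_indic.
by apply/measurable_EFinP; exact: measurable_int intf.
Qed.

Let Rintegral_cst_indic q : \int[m]_t (q * \1_A t) = q * fine (m A).
Proof.
rewrite RintegralZl//; last exact: integrable_indic.
by rewrite /Rintegral intA.
Qed.

Let integrable_cst_indic q : m.-integrable setT (EFin \o (fun t => q * \1_A t)).
Proof.
apply: (integrable_mul_indic (f := cst q)).
exact: finite_measure_integrable_cst.
Qed.

Lemma Rintegral_conditional_ge (f : T -> R) q :
  m.-integrable setT (EFin \o f) -> (forall t, A t -> q <= f t) ->
  q <= \int[conditional A]_t f t.
Proof.
move=> intf qf; rewrite Rintegral_conditional// mulrC ler_pdivlMr//.
rewrite -Rintegral_cst_indic; apply: le_Rintegral => // [|t _].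
  exact: integrable_mul_indic.
rewrite indicE; have [/set_mem/qf|] := boolP (t \in A); first by rewrite !mulr1.
by rewrite !mulr0.
Qed.

Lemma Rintegral_conditional_le (f : T -> R) q :
  m.-integrable setT (EFin \o f) -> (forall t, A t -> f t <= q) ->
  \int[conditional A]_t f t <= q.
Proof.
move=> intf qf; rewrite Rintegral_conditional// mulrC ler_pdivrMr//.
rewrite -Rintegral_cst_indic; apply: le_Rintegral => // [|t _].
  exact: integrable_mul_indic.
rewrite indicE; have [/set_mem/qf|] := boolP (t \in A); first by rewrite !mulr1.
by rewrite !mulr0.
Qed.

End conditioning.

(* Measures are functions on all subsets, so two measures that agree on
   measurable sets need not be equal: continuity makes [G] blind to this. *)
Lemma tv_continuous_ext d (T : measurableType d) (R : realType)
    (D : set (probability T R)) (G : probability T R -> R) mu nu :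
  tv_continuous_on D G -> D mu -> D nu ->
  (forall A, measurable A -> nu A = mu A) -> G nu = G mu.
Proof.
move=> cG Dmu Dnu munu; apply/eqP; rewrite -subr_eq0 -normr_le0.
apply/ler_addgt0Pr => eps eps0; rewrite add0r.
have [delta delta0 /(_ nu Dnu) h] := cG mu Dmu eps eps0.
apply/ltW/h/(@le_lt_trans _ _ 0%E); last by rewrite lte_fin.
apply: ge_ereal_sup => _ [k [A [mA _ ->]]].
rewrite big1// => i _; rewrite munu// subee ?abse0// fin_num_measure//.
Qed.

(** * Atoms of the finite partition generated by a list of sets *)

Fixpoint cell (T : Type) (Es : seq (set T)) (B : set T) (t : T) : set T :=
  if Es is E :: Es' then
    if t \in E then cell Es' (B `&` E) t else cell Es' (B `\` E) t
  else B.

Section cell_theory.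
Context (T : Type).
Implicit Types (Es : seq (set T)) (B E : set T).

Lemma sub_cell Es B t : cell Es B t `<=` B.
Proof.
elim: Es B => [|E Es IH] B //=; case: ifP => _.
  by apply: subset_trans (IH _) _ => s [].
by apply: subset_trans (IH _) _ => s [].
Qed.

Lemma cell_sub_test E Es B t : List.In E Es ->
  forall s, cell Es B t s -> (s \in E) = (t \in E).
Proof.
elim: Es B => [|E' Es IH] B //= [->|EEs] s; last by case: ifP => _; exact: IH.
case: ifPn => tE /sub_cell[_ sE]; first by rewrite mem_set.
by rewrite memNset.
Qed.

End cell_theory.

Section refinement.
Context d (T : measurableType d) (R : realType) (m : probability T R).
Variables (M : set T -> \bar R) (Th : set T -> \bar R).
Hypothesis superM : forall A B, measurable A -> measurable B ->
  [disjoint A & B] -> (M A + M B <= M (A `|` B))%E.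
Hypothesis Th_ge0 : forall A, (0 <= Th A)%E.
Hypothesis Th_le : forall A, measurable A -> (Th A * m A <= M A)%E.

Lemma measurable_cell Es B :
  (forall E, List.In E Es -> measurable E) ->
  measurable_fun setT (fun t => Th (cell Es B t)).
Proof.
elim: Es B => [|E Es IH] B mEs /=; first exact: measurable_cst.
rewrite (_ : (fun _ => _) = (fun t => if t \in E then Th (cell Es (B `&` E) t)
  else Th (cell Es (B `\` E) t))); last by apply/funext => t; case: ifP.
apply: measurable_fun_ifT; last 2 first.
- by apply: IH => E' EE'; apply: mEs; right.
- by apply: IH => E' EE'; apply: mEs; right.
apply: (measurable_fun_bool true); rewrite setTI.
rewrite (_ : _ @^-1` _ = E); first by apply: mEs; left.
by apply/seteqP; split=> t; [move/set_mem|move/mem_set].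
Qed.

(** Each test splits [B] in two, and superadditivity puts the two bounds together; once the tests
    are used up the integrand is constant on [B] and [Th_le] applies. *)
Lemma integral_cell_le Es B : measurable B ->
  (forall E, List.In E Es -> measurable E) ->
  (\int[m]_(t in B) Th (cell Es B t) <= M B)%E.
Proof.
elim: Es B => [|E Es IH] B mB mEs; first by rewrite /= integral_cst// Th_le.
have mE : measurable E by apply: mEs; left.
have mEs' E' : List.In E' Es -> measurable E' by move=> h; apply: mEs; right.
have mBE : measurable (B `&` E) by exact: measurableI.
have mBD : measurable (B `\` E) by exact: measurableD.
have dBE : [disjoint B `&` E & B `\` E].
  by apply/eqP; rewrite -subset0 => t [[_ ?] []].
rewrite -{1 3}(setUIDK B E).
rewrite ge0_integral_setU//; last by apply/measurable_funTS/measurable_cell.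
apply: le_trans (superM mBE mBD dBE); apply: leeD.
  apply: le_trans (IH _ mBE mEs'); rewrite le_eqVlt; apply/orP; left; apply/eqP.
  by apply: eq_integral => t /set_mem[_ tE] /=; rewrite mem_set.
apply: le_trans (IH _ mBD mEs'); rewrite le_eqVlt; apply/orP; left; apply/eqP.
by apply: eq_integral => t /set_mem[_ tE] /=; rewrite memNset.
Qed.

End refinement.

(** * Jensen's inequality for concave functionals of measures *)

Lemma le_limn_einf (R : realType) (u v : (\bar R)^nat) :
  (forall k, (u k <= v k)%E) -> (limn_einf u <= limn_einf v)%E.
Proof.
move=> uv; rewrite !limn_einf_lim.
apply: lee_lim; [exact: is_cvg_einfs|exact: is_cvg_einfs|].
apply: nearW => k; apply/ereal_infP => _ [j kj <-].
by apply: ge_ereal_inf; exists (u j); [exists j|exact: uv].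
Qed.

Section concave_jensen.
Context (R : realType) (X : Type) (n : nat) (x : 'I_n -> X).
Context (d : measure_display) (L : measurableType d) (F : L -> X -> R).
Hypothesis F_measurable : forall z, measurable_fun setT (fun l => F l z).
Context (Psi : probability L R -> R).
Hypothesis Psi_concave : concave_on (admissible x F) Psi.
Hypothesis Psi_continuous : tv_continuous_on (admissible x F) Psi.
Context (m : probability L R) (m_adm : admissible x F m).

Lemma eq_measure_admissible (mu nu : probability L R) : admissible x F mu ->
  (forall A, measurable A -> nu A = mu A) -> admissible x F nu.
Proof.
move=> mu_adm numu i; have /integrableP[mf foo] := mu_adm i.
apply/integrableP; split => //.
by rewrite (eq_measure_integral mu)// => A mA _; exact: numu.
Qed.

Lemma eq_measure_Psi (mu nu : probability L R) : admissible x F mu ->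
  (forall A, measurable A -> nu A = mu A) -> Psi nu = Psi mu.
Proof.
move=> mu_adm numu; apply: (tv_continuous_ext Psi_continuous) => //.
exact: eq_measure_admissible numu.
Qed.

Lemma admissible_conditional A : measurable A -> (0 < m A)%E ->
  admissible x F (conditional m A).
Proof.
move=> mA A0 i.
exact: (integrable_conditional mA A0 (f := fun l => F l (x i)) (m_adm i)).
 Qed.

(** The positively homogeneous extension of [Psi] along restrictions of [m]. Concavity of [Psi]
    becomes superadditivity of [M], a property that can be iterated over the cells of a
    partition. *)
Let M A : \bar R := (fine (m A) * Psi (conditional m A))%:E.

Let super A B : measurable A -> measurable B -> [disjoint A & B] ->
  (M A + M B <= M (A `|` B))%E.
Proof.
(* Conditioning on a null set only returns [m]; the factor [fine (m C)] hides this value. Adding a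
   null piece to [D] changes neither its mass nor the conditional probabilities of measurable
   sets. *)
have null C D : measurable C -> measurable D -> [disjoint C & D] -> m C = 0%E ->
    (M C + M D = M (C `|` D))%E.
  move=> mC mD dCD C0; rewrite /M C0 /= mul0r add0r.
  have CD0 E : measurable E -> m (E `&` (C `|` D)) = m (E `&` D).
    move=> mE; rewrite setIUr measureU//; last 3 first.
    - exact: measurableI.
    - exact: measurableI.
    - rewrite -subset0 => t [[_ Ct] [_ Dt]].
      by have /disj_setPS/(_ t) := dCD; apply.
    rewrite (@subset_measure0 _ _ _ m (E `&` C) C) ?add0e//.
    exact: measurableI.
  have CDE : m (C `|` D) = m D by rewrite -(setTI (C `|` D)) CD0// setTI.
  rewrite CDE; have [D0|] := eqVneq (m D) 0%E; first by rewrite D0 /= !mul0r.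
  rewrite -measure_gt0 => D_gt0; congr (_ * _)%:E; apply/esym/eq_measure_Psi.
    exact: admissible_conditional.
  move=> E mE; rewrite !conditionalE//; first by rewrite CDE CD0.
  - exact: measurableU.
  - by rewrite CDE.
move=> mA mB dAB.
have [A0|] := eqVneq (m A) 0%E; first by rewrite null.
rewrite -measure_gt0 => A_gt0.
have [B0|] := eqVneq (m B) 0%E.
  by rewrite addeC setUC null// disj_set_sym.
rewrite -measure_gt0 => B_gt0.
have Afin : m A \is a fin_num by exact: fin_num_measure.
have Bfin : m B \is a fin_num by exact: fin_num_measure.
have mAB : measurable (A `|` B) by exact: measurableU.
have ABE : m (A `|` B) = (m A + m B)%E.
  by rewrite measureU// -subset0; exact/disj_setPS.
have AB_gt0 : (0 < m (A `|` B))%E by rewrite ABE adde_gt0.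
have a_gt0 : 0 < fine (m A) by rewrite fine_gt0// A_gt0 ltey_eq Afin.
have b_gt0 : 0 < fine (m B) by rewrite fine_gt0// B_gt0 ltey_eq Bfin.
have fAB : fine (m (A `|` B)) = fine (m A) + fine (m B) by rewrite ABE fineD.
rewrite /M fAB -EFinD lee_fin.
set a := fine (m A); set b := fine (m B).
have ab_gt0 : 0 < a + b by exact: addr_gt0.
(* Conditioning on the union is the mixture of the two conditional probabilities with weight a / (a
   + b); concavity multiplied by a + b is the superadditivity sought. *)
have c0 : 0 <= a / (a + b) by rewrite divr_ge0 ?ltW.
have c1 : a / (a + b) <= 1 by rewrite ler_pdivrMr// mul1r lerDl ltW.
have Cc : 1 - a / (a + b) = b / (a + b).
  by rewrite -{1}(divff (lt0r_neq0 ab_gt0)) -mulrBl addrAC subrr add0r.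
have := Psi_concave (Itv01 c0 c1) (admissible_conditional mA A_gt0)
  (admissible_conditional mB B_gt0).
rewrite (@eq_measure_Psi (conditional m (A `|` B))
  (mixture (Itv01 c0 c1) (conditional m A) (conditional m B))); first last.
- move=> E mE; rewrite [LHS]mixtureE !conditionalE//= Cc fAB -/a -/b.
  have EAfin : m (E `&` A) \is a fin_num.
    by apply: fin_num_measure; exact: measurableI.
  have EBfin : m (E `&` B) \is a fin_num.
    by apply: fin_num_measure; exact: measurableI.
  have -> : m (E `&` (A `|` B)) = (fine (m (E `&` A)) + fine (m (E `&` B)))%:E.
    rewrite setIUr measureU ?EFinD ?fineK//; try exact: measurableI.
    rewrite -subset0 => t [[_ At] [_ Bt]].
    by have /disj_setPS/(_ t) := dAB; apply.
  rewrite -(fineK EAfin) -(fineK EBfin) -!EFinM -EFinD; congr EFin.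
  by rewrite /=; field; rewrite !gt_eqF.
- exact: admissible_conditional.
rewrite /= Cc => /(ler_wpM2l (ltW ab_gt0)); apply: le_trans.
by rewrite le_eqVlt; apply/orP; left; apply/eqP; field; rewrite gt_eqF.
Qed.

(** Countably many tests locate all the values [F l (x i)]: rational thresholds for each [i],
    numbered through [pickle]. A number that decodes to nothing gets the trivial test. *)
Let test (k : nat) : set L :=
  if @unpickle ('I_n * rat)%type k is Some (i, q)
  then [set l | F l (x i) < ratr q] else setT.

Let measurable_test k : measurable (test k).
Proof.
rewrite /test; case: unpickle => [[i q]|]; last exact: measurableT.
rewrite -[X in measurable X]setTI.
have := measurable_fun_ltr (F_measurable (x i)) (@measurable_cst _ _ L R setT (ratr q)).
by move=> /(_ measurableT [set true]) => h; apply: h.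
Qed.

Let tests k := [seq test j | j <- iota 0 k].

Let measurable_tests k E : List.In E (tests k) -> measurable E.
Proof.
rewrite /tests; elim: (iota 0 k) => //= j s IH [<-|/IH//].
exact: measurable_test.
Qed.

Let in_tests j k : (j < k)%N -> List.In (test j) (tests k).
Proof.
move=> jk; have : j \in iota 0 k by rewrite mem_iota.
rewrite /tests; elim: (iota 0 k) => //= j' s IH; rewrite inE => /predU1P[->|/IH].
  by left.
by right.
Qed.

Let mean A i := fbar F (conditional m A) (x i).

(** Once two rational thresholds enclosing [F l (x i)] within [eps] are among the tests, [F] stays
    between them on the whole cell, hence so does its mean. On a null cell [conditional] is [m]
    again and its mean is unrelated to [l], whence the case distinction. *)
Let cvg_mean l (A : (set L)^nat) :
  (forall k, measurable (A k)) -> (forall k, A k = cell (tests k) setT l) ->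
  forall i, (if m (A k) == 0%E then F l (x i) else mean (A k) i) @[k --> \oo] -->
    F l (x i).
Proof.
move=> mA AE i; apply/cvgrPdist_le => eps eps0.
have /rat_in_itvoo[q1 /[!in_itv]/= /andP[q1l q1u]] :
  F l (x i) - eps < F l (x i) by rewrite gtrBl.
have /rat_in_itvoo[q2 /[!in_itv]/= /andP[q2l q2u]] :
  F l (x i) < F l (x i) + eps by rewrite ltrDl.
have test1 : test (pickle (i, q1)) = [set l | F l (x i) < ratr q1].
  by rewrite /test pickleK.
have test2 : test (pickle (i, q2)) = [set l | F l (x i) < ratr q2].
  by rewrite /test pickleK.
near=> k; case: ifPn => [_|]; first by rewrite subrr normr0 ltW.
rewrite -measure_gt0 => Ak_gt0.
have k1 : (pickle (i, q1) < k)%N by near: k; exact: nbhs_infty_gt.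
have k2 : (pickle (i, q2) < k)%N by near: k; exact: nbhs_infty_gt.
have b1 t : A k t -> ratr q1 <= F t (x i).
  rewrite AE => /(cell_sub_test (in_tests k1)); rewrite test1 => tl.
  rewrite leNgt; apply/negP => tq; have : t \in [set l | F l (x i) < ratr q1].
    exact/mem_set.
  by rewrite tl => /set_mem/= /(lt_trans q1u); rewrite ltxx.
have b2 t : A k t -> F t (x i) <= ratr q2.
  rewrite AE => /(cell_sub_test (in_tests k2)); rewrite test2 => tl.
  apply/ltW; have : l \in [set l | F l (x i) < ratr q2] by exact/mem_set.
  by rewrite -tl => /set_mem.
have c1 := Rintegral_conditional_ge (mA k) Ak_gt0 (m_adm i) b1.
have c2 := Rintegral_conditional_le (mA k) Ak_gt0 (m_adm i) b2.
rewrite ler_distlC; apply/andP; split.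
  exact: le_trans (ltW q1l) c1.
exact: le_trans c2 (ltW q2u).
Unshelve. all: by end_near. Qed.

(* Concavity applies to finite partitions only; refining them along the values
   of [F] and using the lower semicontinuity of [G] gives the integral form. *)
Lemma concave_jensen (G : ('I_n -> R) -> \bar R) :
  (forall u, 0 <= G u)%E ->
  (forall u (u_ : nat -> 'I_n -> R),
    (forall i, u_ k i @[k --> \oo] --> u i) ->
    (G u <= limn_einf (fun k => G (u_ k)))%E) ->
  (forall mu, admissible x F mu ->
    (G (fun i => fbar F mu (x i)) <= (Psi mu)%:E)%E) ->
  (\int[m]_l G (fun i => F l (x i)) <= (Psi m)%:E)%E.
Proof.
move=> G0 Glsc GPsi.
(* Null cells may get +oo, since they enter the integral as +oo * 0 = 0. *)
pose Th A : \bar R := if m A == 0%E then +oo%E else G (mean A).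
have Th0 A : (0 <= Th A)%E by rewrite /Th; case: ifP.
have ThM A : measurable A -> (Th A * m A <= M A)%E.
  move=> mA; rewrite /Th /M; case: eqP => [->|/eqP]; first by rewrite mule0 mul0r.
  rewrite -measure_gt0 => A_gt0; rewrite mulrC EFinM fineK ?fin_num_measure//.
  by rewrite lee_wpmul2r//; apply/GPsi/admissible_conditional.
have mcell k l : measurable (cell (tests k) setT l).
  elim: (tests k) (@measurable_tests k) setT (@measurableT _ L) => // E s IH mEs B mB.
  have mE : measurable E by apply: mEs; left.
  have mEs' E' : List.In E' s -> measurable E' by move=> h; apply: mEs; right.
  rewrite /=; case: ifP => _; apply: IH => //.
    exact: measurableI.
  exact: measurableD.
apply: (@le_trans _ _ (\int[m]_l limn_einf (fun k => Th (cell (tests k) setT l)))%E).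
  apply: le_ge0_integral => // l.
  (* On null cells the sequence takes the limit value itself, so that it converges for every [l];
     there [Th] is +oo and still dominates. *)
  have := Glsc (fun i => F l (x i)) (fun k i =>
    if m (cell (tests k) setT l) == 0%E then F l (x i)
    else mean (cell (tests k) setT l) i).
  move=> /(_ (cvg_mean (fun k => mcell k l) (fun k => erefl))).
  move=> /le_trans; apply; apply: le_limn_einf => k.
  by rewrite /Th; case: ifP => // _; exact: leey.
apply: (le_trans (fatou m measurableT _ _)) => //.
  by move=> k; apply: measurable_cell => E; exact: measurable_tests.
have [<- _] : (limn_einf (fun=> (Psi m)%:E) = (Psi m)%:E) *
    (limn_esup (fun=> (Psi m)%:E) = (Psi m)%:E).
  by apply: cvg_limn_einf_sup; exact: cvg_cst.
apply: le_limn_einf => k.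
apply: (le_trans (integral_cell_le super Th0 ThM measurableT (@measurable_tests k))).
(* Conditioning on [setT] is known to give back [m] on measurable sets only, hence the passage
   through [eq_measure_Psi]. *)
rewrite /M probability_setT /= mul1r (@eq_measure_Psi m)// => A mA.
rewrite conditionalE// ?probability_setT//.
by rewrite setIT invr1 mul1e.
Qed.

End concave_jensen.

(** * Relative entropy *)

Lemma Rintegral_probability_cst d (T : measurableType d) (R : realType)
  (m : probability T R) (r : R) : \int[m]_t r = r.
Proof.
rewrite /Rintegral integral_cst// [X in (_ * X)%E](_ : _ = 1%E) ?mule1//.
exact: probability_setT.
Qed.

Lemma Rintegral_gt0 d (T : measurableType d) (R : realType)
    (m : probability T R) (f : T -> R) :
  m.-integrable setT (EFin \o f) -> (forall t, 0 < f t) ->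
  0 < \int[m]_t f t.
Proof.
move=> intf f0; have mf := measurable_int m intf.
have If0 : 0 <= \int[m]_t f t by apply: Rintegral_ge0 => t _; exact: ltW.
rewrite lt0r If0 andbT; apply/eqP => I0.
have /(ae_eq_integral_abs m measurableT mf) [N [mN N0 sN]] :
    (\int[m]_t `|(EFin \o f) t| = 0)%E.
  under eq_integral do rewrite gee0_abs ?lee_fin ?ltW//.
  by rewrite -[RHS]/(0%:E) -I0 /Rintegral fineK// integrable_fin_num.
have : m setT = 0%E.
  apply: (subset_measure0 measurableT mN _ N0) => t _; apply: sN => /(_ I).
  by move=> /= [ft0]; have := f0 t; rewrite ft0 ltxx.
by rewrite probability_setT => /eqP; rewrite onee_eq0.
Qed.

(** Bernoulli's inequality x^k >= 1 + k (x - 1) at x = exp y. It follows from exp z >= 1 + z at z =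
    (k - 1) y and at z = - y. *)
Lemma expR_bernoulli (R : realType) (k y : R) : 1 <= k ->
  1 + k * (expR y - 1) <= expR (k * y).
Proof.
move=> k1.
have -> : expR (k * y) = expR y * expR ((k - 1) * y).
  by rewrite -expRD; congr expR; ring.
have h1 : expR y * (1 + (k - 1) * y) <= expR y * expR ((k - 1) * y).
  by rewrite ler_wpM2l ?expR_ge0// expR_ge1Dx.
have h2 : expR y * (1 - y) <= 1.
  rewrite -[leRHS](mulfV (lt0r_neq0 (expR_gt0 y))) -expRN.
  by rewrite ler_wpM2l ?expR_ge0// expR_ge1Dx.
apply: le_trans h1.
have : 0 <= (k - 1) * (1 - expR y * (1 - y)) by rewrite mulr_ge0 ?subr_ge0.
by nra.
Qed.

(** Dividing exp h by its mean exp a reduces the claim to a variable of mean one, for which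
    Bernoulli's inequality at h - a integrates to 1 <= E exp (k (h - a)). *)
Lemma lyapunov_ln_expR d (T : measurableType d) (R : realType)
    (m : probability T R) (h : T -> R) (k : R) : 1 <= k ->
  m.-integrable setT (fun t => (expR (h t))%:E) ->
  m.-integrable setT (fun t => (expR (k * h t))%:E) ->
  k * ln (\int[m]_t expR (h t)) <= ln (\int[m]_t expR (k * h t)).
Proof.
move=> k1 int1 intk.
have Z1 : 0 < \int[m]_t expR (h t) by apply: Rintegral_gt0 => // t; exact: expR_gt0.
have Zk : 0 < \int[m]_t expR (k * h t) by apply: Rintegral_gt0 => // t; exact: expR_gt0.
set a := ln (\int[m]_t expR (h t)).
have aE : expR a = \int[m]_t expR (h t) by rewrite lnK.
rewrite -ler_expR lnK// -[leLHS]mul1r -ler_pdivlMr ?expR_gt0// -expRN mulrC.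
rewrite -RintegralZl//.
have int1' : m.-integrable setT (fun t => (expR (- a) * expR (h t))%:E).
  by apply: eq_integrable (integrableZl measurableT (expR (- a)) int1).
have int2 : m.-integrable setT (fun t => (k * (expR (- a) * expR (h t) - 1))%:E).
  have h1 := integrableB measurableT int1'
    (finite_measure_integrable_cst m 1 measurableT).
  by apply: eq_integrable (integrableZl measurableT k h1).
have int3 : m.-integrable setT (fun t => (1 + k * (expR (- a) * expR (h t) - 1))%:E).
  have h1 := integrableD measurableT
    (finite_measure_integrable_cst m 1 measurableT) int2.
  by apply: eq_integrable h1.
have := @le_Rintegral _ _ _ m setT
  (fun t => 1 + k * (expR (- a) * expR (h t) - 1))
  (fun t => expR (- (k * a)) * expR (k * h t)) measurableT int3.
rewrite RintegralD//; last exact: finite_measure_integrable_cst.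
rewrite (@RintegralZl _ _ _ m setT (fun t => expR (- a) * expR (h t) - 1))//; last first.
  have h1 := integrableB measurableT int1'
    (finite_measure_integrable_cst m 1 measurableT).
  by apply: eq_integrable h1.
rewrite RintegralB//; last exact: finite_measure_integrable_cst.
rewrite RintegralZl// -aE -expRD addNr expR0 Rintegral_probability_cst.
rewrite subrr mulr0 addr0; apply.
  by apply: eq_integrable (integrableZl measurableT (expR (- (k * a))) intk).
move=> t _; rewrite -!expRD -mulrN -mulrDr [- a + _]addrC.
exact: expR_bernoulli.
Qed.

Section kullback_leibler.
Context d (T : measurableType d) (R : realType) (p pi : probability T R).

(** [phi] is a version of the derivative that is real everywhere. It agrees [pi]-almost everywhere
    with the one inside [KL], hence [p]-almost everywhere by domination. *)
Lemma KL_density : p `<< pi -> exists phi : T -> R,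
  [/\ forall t, 0 <= phi t, measurable_fun setT phi,
      forall f : T -> \bar R, measurable_fun setT f -> (forall t, 0 <= f t)%E ->
        (\int[p]_t f t = \int[pi]_t (f t * (phi t)%:E))%E &
      KL p pi = (\int[p]_t (ln (phi t))%:E)%E].
Proof.
move=> ppi; pose RN := Radon_Nikodym_SigmaFinite.f p pi.
have RNfin t : RN t \is a fin_num by exact: Radon_Nikodym_SigmaFinite.f_fin_num.
have mRN : measurable_fun setT RN.
  exact: measurable_int (Radon_Nikodym_SigmaFinite.f_integrable ppi).
exists (fine \o RN); split.
- by move=> t; apply/fine_ge0/Radon_Nikodym_SigmaFinite.f_ge0.
- exact: measurableT_comp.
- move=> f mf f0; rewrite -(Radon_Nikodym_SigmaFinite.change_of_variables ppi)//.
  by apply: eq_integral => t _; rewrite /= fineK.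
rewrite /KL asboolT//; apply: ae_eq_integral => //.
- apply/measurable_EFinP; apply: measurableT_comp; first exact: measurable_ln.
  by apply: measurableT_comp.
- apply/measurable_EFinP; apply: measurableT_comp; first exact: measurable_ln.
  exact: measurableT_comp.
have := null_dominates_ae_eq measurableT ppi
  (ae_eq_Radon_Nikodym_SigmaFinite ppi measurableT).
by apply: filterS => t /= h /h <-.
Qed.

(** Because - x ln x <= 1, the negative part of ln phi has [p]-integral at most 1 whatever the
    divergence; a divergence other than +oo then bounds the positive part as well. *)
Lemma KL_finite : KL p pi != +oo%E -> exists phi : T -> R,
  [/\ forall t, 0 <= phi t, measurable_fun setT phi,
      forall f : T -> \bar R, measurable_fun setT f -> (forall t, 0 <= f t)%E ->
        (\int[p]_t f t = \int[pi]_t (f t * (phi t)%:E))%E,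
      p.-integrable setT (fun t => (ln (phi t))%:E) &
      KL p pi = (\int[p]_t ln (phi t))%:E].
Proof.
move=> KLoo; have ppi : p `<< pi.
  by move: KLoo; rewrite /KL; case: asboolP => // _; rewrite eqxx.
have [phi [phi0 mphi pphi KLE]] := KL_density ppi.
have mln : measurable_fun setT (fun t => (ln (phi t))%:E).
  apply/measurable_EFinP; apply: measurableT_comp => //; exact: measurable_ln.
have neg : (\int[p]_t ((fun t => (ln (phi t))%:E)^\- t) < +oo)%E.
  rewrite pphi//; last exact: measurable_funeneg.
  apply: (@le_lt_trans _ _ (\int[pi]_t (cst 1 t))%E); last first.
    by rewrite integral_cst// mul1e ltey_eq fin_num_measure.
  apply: le_ge0_integral => t; first by rewrite mule_ge0// lee_fin.
  rewrite funenegE maxe_pMl ?lee_fin// mul0e -EFinN -EFinM ge_max lee01 andbT lee_fin.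
  have := phi0 t; rewrite le_eqVlt => /predU1P[<-|phi_gt0]; first by rewrite mulr0.
  have : ln (phi t)^-1 <= (phi t)^-1 - 1.
    have := @le_ln1Dx R ((phi t)^-1 - 1); rewrite addrCA subrr addr0; apply.
    by rewrite ltrBrDl subrr invr_gt0.
  rewrite lnV// => h; rewrite -ler_pdivlMr// mul1r.
  by apply: le_trans h _; rewrite gerBl.
have int_ln : p.-integrable setT (fun t => (ln (phi t))%:E).
  apply/integrableP; split => //.
  rewrite -[X in (\int[_]_x X x)%E]/(abse \o (fun t => (ln (phi t))%:E)).
  rewrite fune_abse ge0_integralD//; last 2 first.
  - exact: measurable_funepos.
  - exact: measurable_funeneg.
  rewrite lte_add_pinfty// ltey; apply: contra KLoo => /eqP pos.
  have negfin : (\int[p]_t ((fun t => (ln (phi t))%:E)^\- t))%E \is a fin_num.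
    by rewrite ge0_fin_numE// integral_ge0.
  by rewrite KLE integralE pos -(fineK negfin).
exists phi; split => //.
by rewrite KLE /Rintegral fineK// integrable_fin_num.
Qed.

Lemma KL_neqNy : KL p pi != -oo%E.
Proof.
have [->//|/KL_finite[phi [_ _ _ _ ->]]//] := eqVneq (KL p pi) +oo%E.
Qed.

(** Jensen's inequality for exp under [p], obtained from the tangent of exp at the mean [c] of u = h
    - ln phi. Changing measure costs an inequality rather than an equality, since [phi] may vanish
    where exp h does not. *)
Lemma donsker_varadhan (h : T -> R) : KL p pi != +oo%E ->
  measurable_fun setT h ->
  p.-integrable setT (fun t => (h t)%:E) ->
  pi.-integrable setT (fun t => (expR (h t))%:E) ->
  \int[p]_t h t - fine (KL p pi) <= ln (\int[pi]_t expR (h t)).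
Proof.
move=> KLoo mh inth inte.
have [phi [phi0 mphi pphi intln ->]] := KL_finite KLoo; rewrite /=.
pose u t := h t - ln (phi t).
have intu : p.-integrable setT (fun t => (u t)%:E).
  by apply: eq_integrable (integrableB measurableT inth intln).
have mu : measurable_fun setT u by apply/measurable_EFinP; exact: measurable_int intu.
rewrite -RintegralB//; set c := Rintegral _ _ _.
have mexpu : measurable_fun setT (fun t => (expR (u t))%:E).
  by apply/measurable_EFinP; exact: measurableT_comp.
have le_expu : (\int[p]_t (expR (u t))%:E <= \int[pi]_t (expR (h t))%:E)%E.
  rewrite pphi//.
  apply: le_ge0_integral => t; rewrite -EFinM lee_fin ?mulr_ge0 ?expR_ge0//.
  have := phi0 t; rewrite le_eqVlt => /predU1P[<-|phi_gt0].
    by rewrite mulr0 expR_ge0.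
  by rewrite /u expRD expRN lnK// mulfVK// gt_eqF.
have intexpu : p.-integrable setT (fun t => (expR (u t))%:E).
  apply/integrableP; split => //.
  under eq_integral do rewrite gee0_abs ?lee_fin ?expR_ge0//.
  by apply: le_lt_trans le_expu _; exact: integrable_lty.
rewrite -ler_expR lnK; last first.
  by rewrite posrE; apply: Rintegral_gt0 => // t; exact: expR_gt0.
apply: (@le_trans _ _ (\int[p]_t expR (u t))); last first.
  by apply: fine_le => //; exact: integrable_fin_num.
have int1 : p.-integrable setT (fun t => (1 + (u t - c))%:E).
  have := integrableD measurableT (finite_measure_integrable_cst p (1 - c) measurableT) intu.
  by apply: eq_integrable => // t _; rewrite /= -EFinD; congr EFin; ring.
have intec : p.-integrable setT (fun t => (expR c * (1 + (u t - c)))%:E).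
  by apply: eq_integrable (integrableZl measurableT (expR c) int1).
have := @le_Rintegral _ _ _ p setT _ _ measurableT intec intexpu.
rewrite RintegralZl//.
have -> : \int[p]_t (1 + (u t - c)) = 1.
  transitivity (\int[p]_t ((1 - c) + u t)).
    by apply: eq_Rintegral => t _; ring.
  rewrite RintegralD//; last exact: finite_measure_integrable_cst.
  by rewrite Rintegral_probability_cst -/c subrK.
rewrite mulr1; apply => t _.
have -> : expR (u t) = expR c * expR (u t - c) by rewrite -expRD addrC subrK.
by rewrite ler_wpM2l ?expR_ge0// expR_ge1Dx.
Qed.

End kullback_leibler.

(** * Integrability by truncation *)

Section equal_laws.
Context (R : realType) d1 (T1 : measurableType d1) d2 (T2 : measurableType d2).
Context (m1 : {measure set T1 -> \bar R}) (m2 : {measure set T2 -> \bar R}).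
Context dT (T : measurableType dT) (S : T1 -> T) (K : T2 -> T).
Hypotheses (mS : measurable_fun setT S) (mK : measurable_fun setT K).
Hypothesis SK : forall B, measurable B ->
  pushforward m1 S B = pushforward m2 K B.

Lemma ge0_integral_same_law (h : T -> \bar R) :
  measurable_fun setT h -> (forall t, 0 <= h t)%E ->
  (\int[m1]_u h (S u) = \int[m2]_w h (K w))%E.
Proof.
move=> mh h0.
rewrite -[LHS](@ge0_integral_pushforward _ _ _ _ _ _ mS _ setT h)//.
rewrite -[RHS](@ge0_integral_pushforward _ _ _ _ _ _ mK _ setT h)//.
by apply: eq_measure_integral => A mA _; exact: SK.
Qed.

Variable (h : T -> R).
Hypothesis mh : measurable_fun setT h.

Lemma integrable_same_law : m2.-integrable setT (fun w => (h (K w))%:E) ->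
  m1.-integrable setT (fun u => (h (S u))%:E).
Proof.
move=> inth; apply/integrableP; split.
  by apply/measurable_EFinP; exact: measurableT_comp.
have := ge0_integral_same_law (h := fun t => (`|h t|)%:E) _ _ => /= ->.
- by have /integrableP[] := inth.
- by apply/measurable_EFinP; exact: measurableT_comp.
- by move=> t; rewrite lee_fin.
Qed.

Lemma integral_same_law :
  (\int[m1]_u (h (S u))%:E = \int[m2]_w (h (K w))%:E)%E.
Proof.
rewrite integralE [RHS]integralE.
have mhE : measurable_fun setT (fun t => (h t)%:E) by exact/measurable_EFinP.
have hp := ge0_integral_same_law (measurable_funepos mhE) (fun t => funepos_ge0 _ t).
have hn := ge0_integral_same_law (measurable_funeneg mhE) (fun t => funeneg_ge0 _ t).
congr (_ - _)%E.
  transitivity (\int[m1]_u ((fun t => (h t)%:E)^\+ (S u)))%E.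
    by apply: eq_integral => u _; rewrite !funeposE.
  by rewrite hp; apply: eq_integral => w _; rewrite !funeposE.
transitivity (\int[m1]_u ((fun t => (h t)%:E)^\- (S u)))%E.
  by apply: eq_integral => u _; rewrite !funenegE.
by rewrite hn; apply: eq_integral => w _; rewrite !funenegE.
Qed.

End equal_laws.

Section fubini_equal_laws.
Context (R : realType) d (Omega : measurableType d) (P : probability Omega R).
Context d' (Omega' : measurableType d') (P' : probability Omega' R).
Context dT (T : measurableType dT) (S : Omega * Omega' -> T) (K : Omega -> T).
Hypotheses (mS : measurable_fun setT S) (mK : measurable_fun setT K).
Hypothesis SK : forall B, measurable B ->
  pushforward (P \x P')%E S B = pushforward P K B.
Variable (h : T -> R).
Hypotheses (mh : measurable_fun setT h)
  (inth : P.-integrable setT (fun w => (h (K w))%:E)).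

Lemma integrable_fubini_same_law :
  P.-integrable setT (fun w => \int[P']_w' (h (S (w, w')))%:E)%E.
Proof. exact: (integrable_fubini_F (integrable_same_law mS mK SK mh inth)). Qed.

Lemma integral_fubini_same_law :
  (\int[P]_w \int[P']_w' (h (S (w, w')))%:E = \int[P]_w (h (K w))%:E)%E.
Proof.
rewrite (integral12_prod_meas1 (integrable_same_law mS mK SK mh inth)).
exact: integral_same_law.
Qed.

End fubini_equal_laws.

Section descent.
Context (R : realType) d (Omega : measurableType d) (P : probability Omega R).
Context d' (Omega' : measurableType d') (P' : probability Omega' R).
Context dT (T : measurableType dT) (S : Omega * Omega' -> T) (K : Omega -> T).
Hypotheses (mS : measurable_fun setT S) (mK : measurable_fun setT K).
Hypothesis SK : forall B, measurable B ->
  pushforward (P \x P')%E S B = pushforward P K B.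
Variables (V l : T -> R) (D : Omega -> R) (a : R).
Hypothesis mV : measurable_fun setT V.
Hypotheses (lV : forall t, l t <= V t) (a_gt0 : 0 < a) (a_lt1 : a < 1).
Hypothesis intl : P.-integrable setT (fun w => (l (K w))%:E).
Hypothesis intV : forall w,
  P'.-integrable setT (fun w' => (V (S (w, w')))%:E).
Hypothesis D_ge0 : forall w, 0 <= D w.
Hypothesis DV : forall w,
  (\int[P']_w' (V (S (w, w')))%:E <= (a * V (K w) - D w)%:E)%E.

Let mVK : measurable_fun setT (fun w => V (K w)).
Proof. exact: measurableT_comp. Qed.

Let intlc (c : R) : P.-integrable setT (fun w => (`|l (K w)| + c)%:E).
Proof.
have h := integrableD measurableT (integrable_norm intl)
  (finite_measure_integrable_cst P c measurableT).
by apply: eq_integrable h.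
Qed.

Let le_lc (g : Omega -> R) c : measurable_fun setT g ->
  (forall w, `|g w| <= `|l (K w)| + c) -> P.-integrable setT (fun w => (g w)%:E).
Proof.
move=> mg gl; apply: le_integrable (intlc c) => //; first exact/measurable_EFinP.
by move=> w _ /=; rewrite lee_fin (le_trans (gl w))// ler_norm.
Qed.

Let neg w := Num.max (- V (K w)) 0.

Let int_neg : P.-integrable setT (fun w => (neg w)%:E).
Proof.
apply: (@le_lc _ 0).
  by apply: measurable_maxr => //; exact: measurable_funN.
move=> w; rewrite addr0 ger0_norm ?le_max ?lexx ?orbT// ge_max normr_ge0 andbT.
by have := lV (K w); have := ler_norm (- l (K w)); rewrite normrN; lra.
Qed.

(** Sent to zero above [c] rather than capped at [c]: with a cap, the pointwise comparison used in
    [int_pos_le] would fail where V exceeds [c]. *)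
Let pos (c : R) w := if V (K w) <= c then Num.max (V (K w)) 0 else 0.

Let mpos c : measurable_fun setT (pos c).
Proof.
apply: measurable_fun_ifT => //; last exact: measurable_maxr.
exact: measurable_fun_ler.
Qed.

Let pos_ge0 c w : 0 <= pos c w.
Proof. by rewrite /pos; case: ifP => // _; rewrite le_max lexx orbT. Qed.

(* [V (K w)] is not known to be integrable yet, but [min V c] and [min (a V) c]
   are, and the mean of the former is at most that of the latter. *)
Let int_pos_le c : 0 <= c ->
  (\int[P]_w (pos c w)%:E <= \int[P]_w (neg w)%:E)%E.
Proof.
move=> c0; pose Vc t := Num.min (V t) c.
have mVc : measurable_fun setT Vc by exact: measurable_minr.
have lVK w : - `|l (K w)| <= V (K w).
  by rewrite (le_trans _ (lV _))// lerNnormlW.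
have lVc w : - `|l (K w)| <= a * V (K w).
  have : a * - `|l (K w)| <= a * V (K w) by rewrite ler_pM2l.
  apply: le_trans; rewrite mulrN lerN2 -[leRHS]mul1r ler_wpM2r// ltW//.
have intVc : P.-integrable setT (fun w => (Vc (K w))%:E).
  apply: (@le_lc _ c); first exact: measurableT_comp.
  move=> w; rewrite ler_norml /Vc; apply/andP; split.
    rewrite le_min; have := lVK w; have := normr_ge0 (l (K w)); lra.
  by rewrite ge_min; apply/orP; right; rewrite lerDr.
have intac : P.-integrable setT (fun w => (Num.min (a * V (K w)) c)%:E).
  apply: (@le_lc _ c).
    by apply: measurable_minr => //; exact: measurable_funM.
  move=> w; rewrite ler_norml; apply/andP; split.
    rewrite le_min; have := lVc w; have := normr_ge0 (l (K w)); lra.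
  by rewrite ge_min; apply/orP; right; rewrite lerDr.
(* The bounded-above [Vc] has the same mean along [K] as along [S]. For fixed [w] its inner mean is
   at most [c], and at most the mean of V, which [DV] and D >= 0 bound by a V (K w). *)
have le_int : (\int[P]_w (Vc (K w))%:E <= \int[P]_w (Num.min (a * V (K w)) c)%:E)%E.
  rewrite -(integral_fubini_same_law mS mK SK mVc intVc).
  apply: le_integral => // [|w _].
    exact: (integrable_fubini_same_law mS mK SK mVc intVc).
  have mVcS : measurable_fun setT (fun w' => Vc (S (w, w'))).
    by apply: measurableT_comp => //; exact: measurableT_comp.
  have intVcS : P'.-integrable setT (fun w' => (Vc (S (w, w')))%:E).
    have h := integrableD measurableT (integrable_norm (intV w))
      (finite_measure_integrable_cst P' c measurableT).
    apply: le_integrable h => //; first exact/measurable_EFinP.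
    move=> w' _ /=; rewrite lee_fin.
    rewrite [leRHS]ger0_norm ?addr_ge0// /Vc ler_norml; apply/andP; split.
      rewrite le_min; have := lerNnormlW (lexx `|V (S (w, w'))|).
      have := normr_ge0 (V (S (w, w'))); lra.
    by rewrite ge_min; apply/orP; right; rewrite lerDr.
  rewrite EFin_min le_min; apply/andP; split.
    apply: (@le_trans _ _ (\int[P']_w' (V (S (w, w')))%:E)%E).
      by apply: le_integral => // w' _; rewrite lee_fin ge_min lexx.
    by apply: (le_trans (DV w)); rewrite lee_fin gerBl.
  have := le_integral measurableT intVcS
    (finite_measure_integrable_cst P' c measurableT).
  have -> : (\int[P']_w' (EFin \o cst c) w' = c%:E)%E.
    rewrite -[LHS]/(\int[P']_w' cst c%:E w')%E integral_cst//.
    rewrite [X in (_ * X)%E](_ : _ = 1%E) ?mule1//.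
    exact: probability_setT.
  by apply => w' _; rewrite lee_fin ge_min lexx orbT.
have a1 : 0 < 1 - a by rewrite subr_gt0.
have intpos : P.-integrable setT (fun w => (pos c w)%:E).
  apply: (@le_lc _ c) => // w; rewrite ger0_norm// /pos; case: ifP => [Vc'|_].
    by rewrite ge_max (le_trans Vc') ?lerDr// addr_ge0.
  by rewrite addr_ge0.
(* Pointwise this is an equality where V <= c; where V > c, [pos] and [neg] vanish and it reads min
   (a V, c) <= c. Combined with [le_int], it leaves (1 - a) times the desired bound. *)
have le_int_sum : (\int[P]_w ((1 - a)%:E * (pos c w)%:E +
      (Num.min (a * V (K w)) c)%:E) <=
    \int[P]_w ((1 - a)%:E * (neg w)%:E + (Vc (K w))%:E))%E.
  apply: le_integral => //.
  - exact: (integrableD measurableT (integrableZl measurableT (1 - a) intpos)).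
  - exact: (integrableD measurableT (integrableZl measurableT (1 - a) int_neg)).
  move=> w _; rewrite -!EFinM -!EFinD lee_fin /pos /neg /Vc.
  have : [\/ V (K w) < 0 /\ V (K w) <= a * V (K w),
             0 < V (K w) /\ a * V (K w) <= V (K w) |
             V (K w) = 0 /\ a * V (K w) = 0].
    case: (ltgtP (V (K w)) 0) => V0; [apply: Or31|apply: Or32|apply: Or33]; split=> //.
    - by rewrite -[leLHS]mul1r ler_wnM2r// ltW.
    - by rewrite -[leRHS]mul1r ler_wpM2r// ltW.
    - by rewrite V0 mulr0.
  rewrite /Num.min /Num.max.
  by move=> [[? ?]|[? ?]|[? ?]];
    repeat match goal with
    | |- context [if ?b then _ else _] => case: (boolP b); rewrite -?leNgt => ?
    end; lra.
move: le_int_sum; rewrite !integralD ?integralZl//; try exact: integrableZl.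
move: (integrable_fin_num measurableT intpos) (integrable_fin_num measurableT int_neg)
  (integrable_fin_num measurableT intVc) (integrable_fin_num measurableT intac) le_int.
case: (\int[P]_w (pos c w)%:E)%E => // I1 _.
case: (\int[P]_w (neg w)%:E)%E => // I2 _.
case: (\int[P]_w (Vc (K w))%:E)%E => // I3 _.
case: (\int[P]_w (Num.min (a * V (K w)) c)%:E)%E => // I4 _.
rewrite -!EFinM -!EFinD !lee_fin => I34 I1234.
by rewrite -(ler_pM2l a1); lra.
Qed.

(** The bound on the mean of [pos c] is uniform in [c], and along the naturals [pos c] eventually
    equals the positive part of V; Fatou's lemma transfers the bound. *)
Lemma integrable_descent : P.-integrable setT (fun w => (V (K w))%:E).
Proof.
have mVE : measurable_fun setT (fun w => (V (K w))%:E) by exact/measurable_EFinP.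
pose p w := Num.max (V (K w)) 0.
have mp : measurable_fun setT (fun w => (p w)%:E).
  by apply/measurable_EFinP; exact: measurable_maxr.
have p0 w : 0 <= p w by rewrite le_max lexx orbT.
have pfin : (\int[P]_w (p w)%:E <= \int[P]_w (neg w)%:E)%E.
  apply: (@le_trans _ _ (\int[P]_w limn_einf (fun k => (pos k%:R w)%:E))%E).
    apply: le_ge0_integral => w; first by rewrite lee_fin.
    have [<- _] : (limn_einf (fun k => (pos k%:R w)%:E) = (p w)%:E) *
        (limn_esup (fun k => (pos k%:R w)%:E) = (p w)%:E).
      apply: cvg_limn_einf_sup; apply: cvg_near_cst.
      near=> k; rewrite /pos ifT//; near: k; exact: nbhs_infty_ger.
    by [].
  apply: (le_trans (fatou P measurableT _ _)) => //.
  - by move=> k; apply/measurable_EFinP; exact: mpos.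
  - by move=> k w _; rewrite lee_fin.
  have [<- _] : (limn_einf (fun=> \int[P]_w (neg w)%:E) = \int[P]_w (neg w)%:E)%E *
      (limn_esup (fun=> \int[P]_w (neg w)%:E) = \int[P]_w (neg w)%:E)%E.
    by apply: cvg_limn_einf_sup; exact: cvg_cst.
  by apply: le_limn_einf => k; exact: int_pos_le.
have intp : P.-integrable setT (fun w => (p w)%:E).
  apply/integrableP; split => //.
  under eq_integral do rewrite gee0_abs ?lee_fin//.
  by apply: le_lt_trans pfin _; exact: integrable_lty.
have h := integrableB measurableT intp int_neg.
apply: eq_integrable h => // w _; rewrite /= -EFinB; congr EFin.
rewrite /p /neg /Num.max; case: ifP => h1; case: ifP => h2; lra.
Unshelve. all: by end_near. Qed.

(** V has the same mean along [S] and along [K], so integrating [DV] gives E D <= (a - 1) E V (K).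
    As a - 1 is negative, the minorant [l] of V yields an upper bound. *)
Lemma descent : (\int[P]_w (D w)%:E <= ((a - 1) * \int[P]_w l (K w))%:E)%E.
Proof.
have intVK := integrable_descent.
have intG := integrable_fubini_same_law mS mK SK mV intVK.
have GE := integral_fubini_same_law mS mK SK mV intVK.
apply: (@le_trans _ _ (\int[P]_w
    (a%:E * (V (K w))%:E - \int[P']_w' (V (S (w, w')))%:E))%E).
  apply: le_ge0_integral => w; first by rewrite lee_fin.
  have := DV w; have := integrable_fin_num measurableT (intV w).
  case: (\int[P']_w' (V (S (w, w')))%:E)%E => // r _.
  by rewrite -EFinM -EFinB !lee_fin => h; lra.
rewrite integralB//; last exact: integrableZl.
rewrite integralZl// GE.
have : (\int[P]_w (l (K w))%:E <= \int[P]_w (V (K w))%:E)%E.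
  by apply: le_integral => // w _; rewrite lee_fin.
rewrite /Rintegral; move: (integrable_fin_num measurableT intVK)
  (integrable_fin_num measurableT intl).
case: (\int[P]_w (V (K w))%:E)%E => // I1 _.
case: (\int[P]_w (l (K w))%:E)%E => // I2 _.
rewrite -EFinM -EFinB !lee_fin /= => I21.
have := a_lt1; nra.
Qed.

End descent.

(** * Exponential weights *)

Section exponents.
Context (R : realType) (X : Type) (n : nat) (x : 'I_n -> X) (f : X -> R).
Context (d : measure_display) (L : measurableType d) (F : L -> X -> R).
Hypothesis F_measurable : forall z, measurable_fun setT (fun l => F l z).
Variables (beta : R).
Hypothesis beta_gt0 : 0 < beta.

Definition residual i l := f (x i) - F l (x i).

Definition exponent (k : R) (t : 'I_n -> R) l :=
  - (k * \sum_i residual i l ^+ 2 + 2 * \sum_i t i * residual i l) / beta.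

Lemma measurable_residual i : measurable_fun setT (residual i).
Proof. exact: measurable_funB. Qed.

Lemma measurable_exponent_comp dU (U : measurableType dU) (k : R)
    (t : U -> 'I_n -> R) (l : U -> L) :
  (forall i, measurable_fun setT (t ^~ i)) -> measurable_fun setT l ->
  measurable_fun setT (fun u => exponent k (t u) (l u)).
Proof.
move=> mt ml; apply: measurable_funM => //; apply: measurable_funN.
have mr i : measurable_fun setT (fun u => residual i (l u)).
  by apply: measurableT_comp => //; exact: measurable_residual.
apply: measurable_funD; apply: measurable_funM => //; apply: measurable_sum => i.
  exact: measurable_funX.
exact: measurable_funM.
Qed.

Lemma measurable_exponent k t : measurable_fun setT (exponent k t).
Proof. exact: (measurable_exponent_comp k (t := fun=> t)). Qed.

Lemma exponentD k1 k2 t1 t2 l :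
  exponent (k1 + k2) (fun i => t1 i + t2 i) l = exponent k1 t1 l + exponent k2 t2 l.
Proof.
rewrite /exponent -mulrDl; congr (_ / _).
have -> : \sum_i (t1 i + t2 i) * residual i l =
    \sum_i t1 i * residual i l + \sum_i t2 i * residual i l.
  by rewrite -big_split; apply: eq_bigr => i _; rewrite mulrDl.
by ring.
Qed.

Lemma exponentZ k t l : exponent k (fun i => k * t i) l = k * exponent 1 t l.
Proof.
rewrite /exponent mulrA; congr (_ / _).
have -> : \sum_i k * t i * residual i l = k * \sum_i t i * residual i l.
  by rewrite mulr_sumr; apply: eq_bigr => i _; rewrite mulrA.
by ring.
Qed.

Lemma exponent_le (k : R) t l : 0 < k -> exponent k t l <= (k^-1 * \sum_i t i ^+ 2) / beta.
Proof.
move=> k0; rewrite ler_pM2r ?invr_gt0// -subr_ge0 opprK.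
rewrite !mulr_sumr -!big_split/=; apply: sumr_ge0 => i _.
rewrite (_ : _ + _ = k^-1 * (t i + k * residual i l) ^+ 2).
  by rewrite mulr_ge0 ?sqr_ge0// invr_ge0 ltW.
by field; rewrite gt_eqF.
Qed.

Lemma integrable_expR_exponent (m : probability L R) (k : R) t : 0 < k ->
  m.-integrable setT (fun l => (expR (exponent k t l))%:E).
Proof.
move=> k0; set C := expR ((k^-1 * \sum_i t i ^+ 2) / beta).
apply: (le_integrable measurableT _ _
    (finite_measure_integrable_cst m C measurableT)).
  apply/measurable_EFinP; apply: measurableT_comp => //.
  exact: measurable_exponent.
move=> l _ /=; rewrite lee_fin !ger0_norm ?expR_ge0// ler_expR.
exact: exponent_le.
Qed.

End exponents.

Section aggregate.
Context (R : realType) (X : Type) (n : nat) (n_gt0 : (0 < n)%N).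
Context (x : 'I_n -> X) (f : X -> R).
Context (d : measure_display) (L : measurableType d) (F : L -> X -> R).
Hypothesis F_measurable : forall z, measurable_fun setT (fun l => F l z).
Context (pi : probability L R) (beta : R).
Hypothesis beta_gt0 : 0 < beta.
Hypothesis pi_integrable : forall (y : 'I_n -> R) i,
  pi.-integrable setT (fun l => (theta x F beta pi y l * F l (x i))%:E).

Local Notation expo := (exponent x f F beta).

Let nR_gt0 : 0 < n%:R :> R.
Proof. by rewrite ltr0n. Qed.

Let nR_neq0 : n%:R != 0 :> R.
Proof. by rewrite gt_eqF. Qed.

Definition partition_fun (k : R) (t : 'I_n -> R) : R :=
  \int[pi]_l expR (expo k t l).

Lemma partition_fun_gt0 (k : R) t : 0 < k -> 0 < partition_fun k t.
Proof.
move=> k0; apply: Rintegral_gt0 => [|l]; last exact: expR_gt0.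
exact: integrable_expR_exponent.
Qed.

Let expR_exponent_ge0 k t l : 0 <= expR (expo k t l).
Proof. exact: expR_ge0. Qed.

Let measurable_expR_exponent k t : measurable_fun setT (fun l => expR (expo k t l)).
Proof. by apply: measurableT_comp => //; exact: measurable_exponent. Qed.

Definition posterior s : probability L R :=
  tilt pi (expR_exponent_ge0 1 s) (measurable_expR_exponent 1 s).

Let integral_expR_exponent (k : R) t : 0 < k ->
  (\int[pi]_l (expR (expo k t l))%:E = (partition_fun k t)%:E)%E.
Proof.
move=> k0; rewrite /partition_fun /Rintegral fineK//.
by apply: integrable_fin_num => //; exact: integrable_expR_exponent.
Qed.

Variable s : 'I_n -> R.
Let y i := f (x i) + s i.

Lemma theta_exponent l :
  theta x F beta pi y l = expR (expo 1 s l) / partition_fun 1 s.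
Proof.
have gE l' : gibbs x F beta y l' =
    expR (- (\sum_i s i ^+ 2) / beta) * expR (expo 1 s l').
  rewrite /gibbs /sqnorm_n -expRD; congr expR.
  rewrite mulrA mulfV// mul1r /exponent -mulNr -mulrDl; congr (_ / _).
  rewrite mul1r mulr_sumr -!sumrN -big_split -!sumrN -big_split/=.
  by apply: eq_bigr => i _; rewrite /y /residual; ring.
rewrite /theta; under eq_Rintegral do rewrite gE.
rewrite gE RintegralZl//; last exact: integrable_expR_exponent.
by rewrite -mulf_div divff ?mul1r// gt_eqF ?expR_gt0.
Qed.

Let integrable_mul i : pi.-integrable setT (fun l => (F l (x i) * expR (expo 1 s l))%:E).
Proof.
have := integrableZl measurableT (partition_fun 1 s) (pi_integrable y i).
apply: eq_integrable => // l _; rewrite -EFinM theta_exponent; congr EFin.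
by field; rewrite gt_eqF// partition_fun_gt0.
Qed.

Lemma posterior_admissible : admissible x F (posterior s).
Proof.
move=> i; apply: (integrable_tilt _ _ (partition_fun_gt0 s ltr01) _ (f := fun l => F l (x i))) => //.
exact: integral_expR_exponent.
Qed.

Lemma ewa_fbar i : ewa x F beta pi y (x i) = fbar F (posterior s) (x i).
Proof.
rewrite /fbar (Rintegral_tilt _ _ (partition_fun_gt0 s ltr01) _ (f := fun l => F l (x i)))//; last first.
  exact: integral_expR_exponent.
rewrite -RintegralZl//; last exact: integrable_mul.
rewrite /ewa; apply: eq_Rintegral => l _.
by rewrite theta_exponent; ring.
Qed.

Let m i := fbar F (posterior s) (x i).

(** The left-hand side of (C) before the expectation in [zeta], here [z], with the posterior as
    second measure and [u] for the values of [fbar] at the first. A free vector [u] can run through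
    limits of cell means. *)
Definition excess (u z : 'I_n -> R) : R :=
  expR ((n%:R^-1 * \sum_i (f (x i) - m i) ^+ 2 -
         n%:R^-1 * \sum_i (f (x i) - u i) ^+ 2) / beta) *
  \prod_i expR (z i * (2 * (u i - m i) / beta)).

(** Since F l - m = (f - m) - r, the product contributes terms linear in r and the first factor the
    quadratic one, with weight 1/n. Up to a factor free of [l], [excess] is thus one more
    exponential weight, and its posterior mean a ratio of partition functions. *)
Lemma excess_exponent z l : excess (fun i => F l (x i)) z =
  expR ((n%:R^-1 * \sum_i (f (x i) - m i) ^+ 2 +
         2 * \sum_i z i * (f (x i) - m i)) / beta) * expR (expo n%:R^-1 z l).
Proof.
rewrite /excess -expR_sum -!expRD; congr expR; rewrite /exponent.
have -> : \sum_i z i * (2 * (F l (x i) - m i) / beta) =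
    (2 * \sum_i z i * (f (x i) - m i) - 2 * \sum_i z i * residual x f F i l) / beta.
  rewrite !mulr_sumr -sumrN -big_split mulr_suml/=.
  by apply: eq_bigr => i _; rewrite /residual; field; rewrite gt_eqF.
by rewrite /residual; field; rewrite gt_eqF.
Qed.

Let invn_gt0 : 0 < n%:R^-1 :> R.
Proof. by rewrite invr_gt0. Qed.

Lemma integrable_excess z :
  (posterior s).-integrable setT (fun l => (excess (fun i => F l (x i)) z)%:E).
Proof.
set C := expR ((n%:R^-1 * \sum_i (f (x i) - m i) ^+ 2 +
         2 * \sum_i z i * (f (x i) - m i)) / beta).
have := integrableZl measurableT C
  (integrable_expR_exponent x f F_measurable beta_gt0 (posterior s) z invn_gt0).
by apply: eq_integrable => // l _; rewrite excess_exponent EFinM.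
Qed.

(* With [N] the posterior mean of [excess], completing the square at [m] shows
   that the log-ratio of partition functions is [ln N <= N - 1] minus the two
   quadratic and linear terms. *)
Lemma ln_partition_fun_le z :
  ln (partition_fun (1 + n%:R^-1) (fun i => s i + z i)) <=
  ln (partition_fun 1 s) -
  (n%:R^-1 * \sum_i (f (x i) - m i) ^+ 2 +
   2 * \sum_i z i * (f (x i) - m i)) / beta +
  \int[posterior s]_l excess (fun i => F l (x i)) z - 1.
Proof.
set Q := (_ / beta).
have Z1 := partition_fun_gt0 s ltr01.
have Zk : 0 < partition_fun (1 + n%:R^-1) (fun i => s i + z i).
  by apply: partition_fun_gt0; rewrite addr_gt0.
have NE : \int[posterior s]_l excess (fun i => F l (x i)) z =
    expR Q * ((partition_fun 1 s)^-1 * partition_fun (1 + n%:R^-1) (fun i => s i + z i)).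
  under eq_Rintegral do rewrite excess_exponent.
  rewrite RintegralZl//; last exact: integrable_expR_exponent.
  congr (_ * _); rewrite (Rintegral_tilt _ _ Z1 _ (f := fun l => expR (expo n%:R^-1 z l)))//.
  - congr (_ * _); rewrite /partition_fun; apply: eq_Rintegral => l _.
    by rewrite exponentD -expRD addrC.
  - exact: integral_expR_exponent.
  - have := integrable_expR_exponent x f F_measurable beta_gt0 pi
      (fun i => s i + z i) (addr_gt0 ltr01 invn_gt0).
    apply: eq_integrable => // l _.
    by rewrite exponentD -expRD addrC.
set N := Rintegral _ _ _ in NE *.
have N_gt0 : 0 < N by rewrite NE !mulr_gt0 ?expR_gt0 ?invr_gt0.
have : ln N <= N - 1.
  have := @le_ln1Dx R (N - 1); rewrite addrCA subrr addr0; apply.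
  by rewrite ltrBrDl subrr.
rewrite {1}NE lnM ?posrE ?mulr_gt0 ?expR_gt0 ?invr_gt0// expRK.
rewrite lnM ?posrE ?invr_gt0// lnV ?posrE//.
by move: (ln _) (ln _) Q N {NE N_gt0} => u v Q N; lra.
Qed.

End aggregate.

(** * The mean of the excess over the auxiliary noise *)

Lemma cvg_bigsum (R : realType) (I : Type) (s : seq I) (g : I -> R^nat) (l : I -> R) :
  (forall i, g i k @[k --> \oo] --> l i) ->
  \sum_(i <- s) g i k @[k --> \oo] --> \sum_(i <- s) l i.
Proof.
move=> gl; elim: s => [|i s IH].
  by rewrite big_nil; under eq_fun do rewrite big_nil; exact: cvg_cst.
by rewrite big_cons; under eq_fun do rewrite big_cons; exact: cvgD.
Qed.

(** All the other factors are positive, so an infinite one would make the whole product infinite. *)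
Lemma prode_lty_factor (R : realType) (I : finType) (a : I -> \bar R) (r : R) (c : R) :
  0 < c -> (forall i, 0 < a i)%E -> (c%:E * \prod_i a i <= r%:E)%E ->
  forall j, (a j < +oo)%E.
Proof.
move=> c0 a0 + j; rewrite (bigD1 j)//=; case: ltP => //.
rewrite leye_eq => /eqP ->; rewrite gt0_mulye; last first.
  by apply: (big_ind (fun y : \bar R => 0 < y)%E) => //; exact: mule_gt0.
by rewrite gt0_muley ?lte_fin.
Qed.

Section expected_excess.
Context (R : realType) (X : Type) (n : nat) (n_gt0 : (0 < n)%N).
Context (x : 'I_n -> X) (f : X -> R).
Context (d : measure_display) (L : measurableType d) (F : L -> X -> R).
Hypothesis F_measurable : forall z, measurable_fun setT (fun l => F l z).
Context (pi : probability L R) (beta : R).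
Hypothesis beta_gt0 : 0 < beta.
Hypothesis pi_integrable : forall (y : 'I_n -> R) i,
  pi.-integrable setT (fun l => (theta x F beta pi y l * F l (x i))%:E).
Context (d' : measure_display) (Omega' : measurableType d').
Context (P' : probability Omega' R) (zeta : 'I_n -> {RV P' >-> R}).
Hypothesis zeta_iid : iid zeta.
Let i1 := Ordinal n_gt0.
Context (Psi : probability L R -> probability L R -> R).
Hypothesis Psi_ge : forall mu mu', admissible x F mu -> admissible x F mu' ->
    ((expR ((sqdist_n x f (fbar F mu') - sqdist_n x f (fbar F mu)) / beta))%:E
       * \prod_(i < n) mmt_gen_fun P' (zeta i1)
           (2 * (fbar F mu (x i) - fbar F mu' (x i)) / beta)%R
     <= (Psi mu mu')%:E)%E.
Hypothesis Psi_concave : forall mu', admissible x F mu' ->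
    concave_on (admissible x F) (fun mu => Psi mu mu') /\
    tv_continuous_on (admissible x F) (fun mu => Psi mu mu').
Hypothesis Psi1 : forall mu, admissible x F mu -> Psi mu mu = 1.
Variable s : 'I_n -> R.

Local Notation post := (posterior x f F_measurable pi beta s).
Local Notation exc := (excess x f F_measurable pi beta s).

Let post_adm : admissible x F post.
Proof. exact: (posterior_admissible n_gt0 f F_measurable beta_gt0 pi_integrable). Qed.

Let m i := fbar F post (x i).

Lemma excess_ge0 u z : 0 <= exc u z.
Proof.
by rewrite /excess mulr_ge0 ?expR_ge0// prodr_ge0// => i _; exact: expR_ge0.
Qed.

Lemma measurable_excess dU (U : measurableType dU) (u z : U -> 'I_n -> R) :
  (forall i, measurable_fun setT (u ^~ i)) ->
  (forall i, measurable_fun setT (z ^~ i)) ->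
  measurable_fun setT (fun t => exc (u t) (z t)).
Proof.
move=> mu mz; apply: measurable_funM.
  apply: measurableT_comp => //; apply: measurable_funM => //.
  apply: measurable_funB => //; apply: measurable_funM => //.
  by apply: measurable_sum => i; apply: measurable_funX; exact: measurable_funB.
apply: measurable_prod => i _; apply: measurableT_comp => //.
apply: measurable_funM => //; apply: measurable_funM => //.
by apply: measurable_funM => //; exact: measurable_funB.
Qed.

Let G u : \bar R := (\int[P']_w (exc u (fun i => zeta i w))%:E)%E.

Let mexcG u : measurable_fun setT (fun w => (exc u (fun i => zeta i w))%:E).
Proof. by apply/measurable_EFinP; exact: measurable_excess. Qed.

(** The integrand is continuous in [u], but the moment generating function of [zeta] may take the
    value +oo and no domination is at hand; Fatou's lemma gives the one-sided statement. *)
Let G_lsc u (u_ : nat -> 'I_n -> R) :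
  (forall i, u_ k i @[k --> \oo] --> u i) ->
  (G u <= limn_einf (fun k => G (u_ k)))%E.
Proof.
move=> uu; apply: le_trans (fatou P' measurableT _ _) => //; last first.
  by move=> k w _; rewrite lee_fin excess_ge0.
apply: le_ge0_integral => w; first by rewrite lee_fin excess_ge0.
set e := (X in (X <= _)%E).
have [-> //] : (limn_einf (fun k => (exc (u_ k) (fun i => zeta i w))%:E) = e) *
    (limn_esup (fun k => (exc (u_ k) (fun i => zeta i w))%:E) = e).
apply: cvg_limn_einf_sup; apply: cvg_EFin; first exact: nearW.
have uB i c : (c - u_ k i) @[k --> \oo] --> c - u i.
  by apply: cvgB => //; exact: cvg_cst.
rewrite /excess -expR_sum -expRD /comp /=.
under eq_fun do rewrite -expR_sum -expRD.
apply: continuous_cvg; first exact: continuous_expR.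
apply: cvgD.
  apply: cvgMl; apply: cvgB; first exact: cvg_cst.
  apply: cvgMr; apply: cvg_bigsum => i; under eq_fun do rewrite expr2.
  by rewrite expr2; exact: cvgM.
apply: cvg_bigsum => i; apply: cvgMr; apply: cvgMl; apply: cvgMr.
by apply: cvgB => //; exact: cvg_cst.
Qed.

(** Independence and equal laws factor the mean into moment generating functions, which is the
    left-hand side of (C). The product formula asks for finite factors; these come from [Psi] being
    real-valued. *)
Let G_le mu : admissible x F mu ->
  (G (fun i => fbar F mu (x i)) <= (Psi mu post)%:E)%E.
Proof.
move=> mu_adm; apply: le_trans (Psi_ge mu_adm post_adm).
pose h i (r : R) := expR (r * (2 * (fbar F mu (x i) - m i) / beta)).
have mh i : measurable_fun setT (h i).
  by apply: measurableT_comp => //; exact: measurable_funM.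
have hE i : (\int[P']_w (h i (zeta i w))%:E = mmt_gen_fun P' (zeta i1)
    (2 * (fbar F mu (x i) - fbar F post (x i)) / beta)%R)%E.
  rewrite /mmt_gen_fun unlock.
  apply: (ge0_integral_same_law (S := zeta i) (K := zeta i1) _ _ _
    (h := fun r => (h i r)%:E)) => //.
  - by move=> B mB; exact: (zeta_iid.2 i i1).
  - exact/measurable_EFinP.
  - by move=> r; rewrite lee_fin expR_ge0.
have L_gt0 i : (0 < \int[P']_w (h i (zeta i w))%:E)%E.
  rewrite lt0e integral_ge0 ?andbT; last by move=> w _; rewrite lee_fin expR_ge0.
  apply/eqP => I0.
  have inth : P'.-integrable setT (EFin \o (fun w => h i (zeta i w))).
    apply/integrableP; split.
      by apply/measurable_EFinP; exact: measurableT_comp.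
    under eq_integral do rewrite gee0_abs ?lee_fin ?expR_ge0//.
    by rewrite I0 ltry.
  have := Rintegral_gt0 inth (fun w => expR_gt0 _).
  by rewrite /Rintegral I0 /= ltxx.
have L_lty : forall i, (\int[P']_w (h i (zeta i w))%:E < +oo)%E.
  apply: (prode_lty_factor (expR_gt0 _) L_gt0).
  by under eq_bigr do rewrite hE; exact: (Psi_ge mu_adm post_adm).
rewrite /G /excess.
under eq_integral do rewrite EFinM.
rewrite ge0_integralZl//; last 2 first.
- apply/measurable_EFinP; apply: measurable_prod => i _.
  exact: (measurableT_comp (mh i)).
- by move=> w _; rewrite lee_fin prodr_ge0// => i _; exact: expR_ge0.
rewrite (expectation_prod_indep zeta_iid.1 mh _ L_lty); last first.
  by move=> i r; exact: expR_ge0.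
by rewrite (eq_bigr _ (fun i _ => hE i)).
Qed.

Lemma expected_excess_le1 :
  (\int[P']_w \int[post]_l (exc (fun i => F l (x i)) (fun i => zeta i w))%:E <= 1)%E.
Proof.
have mE : measurable_fun setT (fun u : Omega' * L =>
    (exc (fun i => F u.2 (x i)) (fun i => zeta i u.1))%:E).
  apply/measurable_EFinP; apply: measurable_excess => i.
    exact: (measurableT_comp (F_measurable (x i)) measurable_snd).
  exact: (measurableT_comp (measurable_funPT (zeta i)) measurable_fst).
have := fubini_tonelli (m1 := P') (m2 := post) _ mE.
move=> /(_ (fun u => _)) /= ->; last by move=> u; rewrite lee_fin excess_ge0.
have [concave_Psi continuous_Psi] := Psi_concave post_adm.
have G0 u : (0 <= G u)%E.
  by apply: integral_ge0 => w _; rewrite lee_fin excess_ge0.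
have := concave_jensen F_measurable concave_Psi continuous_Psi post_adm
  G0 G_lsc G_le.
by rewrite Psi1.
Qed.

End expected_excess.

(** * First moments of the noises and the risk bound *)

Lemma norm_le_sandwich (R : realDomainType) (a v b : R) :
  a <= v -> v <= b -> `|v| <= `|a| + `|b|.
Proof.
move=> av vb; rewrite ler_norml; apply/andP; split.
  by have := ler_norm (- a); have := normr_ge0 b; rewrite normrN; lra.
by have := ler_norm b; have := normr_ge0 a; lra.
Qed.

Section linear_combination.
Context d (T : measurableType d) (R : realType) (m : probability T R).
Context (n : nat) (t : 'I_n -> R) (g : 'I_n -> T -> R).
Hypothesis intg : forall i, m.-integrable setT (fun u => (g i u)%:E).

Lemma integrable_lincomb :
  m.-integrable setT (fun u => (\sum_i t i * g i u)%:E).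
Proof.
have h := integrable_sum measurableT (index_enum 'I_n) (P := xpredT)
  (fun i _ => integrableZl measurableT (t i) (intg i)).
by apply: eq_integrable h => // u _; rewrite -sumEFin.
Qed.

Lemma Rintegral_lincomb :
  \int[m]_u (\sum_i t i * g i u) = \sum_i t i * \int[m]_u g i u.
Proof.
rewrite -[RHS]/(fine (\sum_i t i * \int[m]_u g i u)%:E) -sumEFin.
congr fine; under eq_integral do rewrite -sumEFin.
rewrite integral_sum//; last first.
  by move=> i; exact: (integrableZl measurableT (t i) (intg i)).
apply: eq_bigr => i _; under eq_integral do rewrite EFinM.
by rewrite integralZl// EFinM /Rintegral fineK// integrable_fin_num.
Qed.

End linear_combination.

(** By (B1), xi + zeta inherits integrability and zero mean from k xi; subtracting xi passes both to
    [zeta i1], and equal laws to the other coordinates. *)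
Lemma zeta_centered (R : realType) (d : measure_display)
    (Omega : measurableType d) (P : probability Omega R) (n : nat)
    (i1 : 'I_n) (xi : 'I_n -> {RV P >-> R}) (d' : measure_display)
    (Omega' : measurableType d') (P' : probability Omega' R)
    (e : {mfun Omega' >-> Omega}) (zeta : 'I_n -> {RV P' >-> R}) (k : R) :
  P.-integrable setT (EFin \o xi i1) -> ('E_P[xi i1] = 0)%E ->
  enlargement P P' e -> iid zeta ->
  same_law P' (fun w => xi i1 (e w) + zeta i1 w) (fun w => k * xi i1 (e w)) ->
  forall i, P'.-integrable setT (fun w => (zeta i w)%:E) /\
    (\int[P']_w (zeta i w)%:E = 0)%E.
Proof.
move=> int_xi xi0 enl zeta_iid B1 i.
have mxi : measurable_fun setT (xi i1) by [].
have me : measurable_fun setT e by [].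
have mid : measurable_fun setT (id : R -> R) by [].
have mxie : measurable_fun setT (fun w => xi i1 (e w)).
  exact: (measurableT_comp mxi me).
have int_xie : P'.-integrable setT (fun w => (xi i1 (e w))%:E).
  exact: (integrable_same_law me (K := id) _ enl mxi).
have xie0 : (\int[P']_w (xi i1 (e w))%:E = 0)%E.
  rewrite (integral_same_law me (K := id) _ enl mxi)//.
  by move: xi0; rewrite unlock.
have mY : measurable_fun setT (fun w => xi i1 (e w) + zeta i1 w).
  exact: measurable_funD.
have mkY : measurable_fun setT (fun w => k * xi i1 (e w)) by exact: measurable_funM.
have int_kY : P'.-integrable setT (fun w => (k * xi i1 (e w))%:E).
  by apply: eq_integrable (integrableZl measurableT k int_xie).
have int_Y := integrable_same_law mY mkY B1 mid int_kY.
have Y0 : (\int[P']_w (xi i1 (e w) + zeta i1 w)%:E = 0)%E.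
  rewrite (integral_same_law mY mkY B1 mid).
  by under eq_integral do rewrite EFinM; rewrite integralZl// xie0 mule0.
have int_zeta1 : P'.-integrable setT (fun w => (zeta i1 w)%:E).
  have h := integrableB measurableT int_Y int_xie.
  by apply: eq_integrable h => // w _; rewrite -EFinB addrC addKr.
have zeta10 : (\int[P']_w (zeta i1 w)%:E = 0)%E.
  transitivity (\int[P']_w ((xi i1 (e w) + zeta i1 w)%:E - (xi i1 (e w))%:E))%E.
    by apply: eq_integral => w _; rewrite -EFinB addrC addKr.
  by rewrite integralB// Y0 xie0 sube0.
have mz j : measurable_fun setT (zeta j) by [].
split.
  exact: (integrable_same_law (mz i) (mz i1) (zeta_iid.2 i i1) mid).
by rewrite (integral_same_law (mz i) (mz i1) (zeta_iid.2 i i1) mid).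
Qed.

Theorem theorem2 (R : realType)
  (* the regression model Y_i = f (x i) + xi i *)
  (d : measure_display) (Omega : measurableType d) (P : probability Omega R)
  (X : Type) (n : nat) (n_gt0 : (0 < n)%N) (x : 'I_n -> X) (f : X -> R)
  (xi : 'I_n -> {RV P >-> R})
  (xi_iid : iid xi)
  (xi_integrable : forall i, P.-integrable setT (EFin \o xi i))
  (xi_centered : forall i, ('E_P[xi i] = 0)%E)
  (* the family F of functions and the prior pi *)
  (dL : measure_display) (L : measurableType dL) (F : L -> X -> R)
  (F_measurable : forall z, measurable_fun setT (fun l => F l z))
  (pi : probability L R)
  (pi_integrable : forall (y : 'I_n -> R) (beta : R), 0 < beta -> forall i,
    pi.-integrable setT (fun l => (theta x F beta pi y l * F l (x i))%:E))
  (* assumption (B) *)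
  (d' : measure_display) (Omega' : measurableType d')
  (P' : probability Omega' R) (e : {mfun Omega' >-> Omega})
  (Omega'_enlarges : enlargement P P' e)
  (zeta : 'I_n -> {RV P' >-> R})
  (zeta_iid : iid zeta)
  (i1 := Ordinal n_gt0)
  (B1 : same_law P' (fun w => xi i1 (e w) + zeta i1 w)
                    (fun w => (1 + n%:R^-1) * xi i1 (e w)))
  (B2 : independent_vectors P' zeta (fun i => xi i \o e))
  (* assumption (C) *)
  (L_zeta := fun t : R => mmt_gen_fun P' (zeta i1) t)
  (beta0 : R) (beta0_gt0 : 0 < beta0)
  (Psi : R -> probability L R -> probability L R -> R)
  (C1 : forall beta, beta0 <= beta ->
    forall mu mu', admissible x F mu -> admissible x F mu' ->
    ((expR ((sqdist_n x f (fbar F mu') - sqdist_n x f (fbar F mu)) / beta))%:E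
       * \prod_(i < n) L_zeta (2 * (fbar F mu (x i) - fbar F mu' (x i)) / beta)%R
     <= (Psi beta mu mu')%:E)%E)
  (C2 : forall beta, beta0 <= beta -> forall mu', admissible x F mu' ->
    concave_on (admissible x F) (fun mu => Psi beta mu mu') /\
    tv_continuous_on (admissible x F) (fun mu => Psi beta mu mu'))
  (C3 : forall beta, beta0 <= beta -> forall mu, admissible x F mu ->
    Psi beta mu mu = 1) :
  forall beta, beta0 <= beta -> forall p : probability L R,
    ('E_P[fun w =>
        sqdist_n x (ewa x F beta pi (fun i => f (x i) + xi i w)%R) f]
     <= \int[p]_l (sqdist_n x (F l) f)%:E
        + beta%:E * KL p pi * (n.+1%:R^-1)%:E)%E.
Proof.
move=> beta beta0_le p.
have beta_gt0 : 0 < beta by exact: lt_le_trans beta0_le.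
have nR_gt0 : 0 < n%:R :> R by rewrite ltr0n.
pose k : R := 1 + n%:R^-1.
have k_gt1 : 1 < k by rewrite ltrDl invr_gt0.
have k_gt0 : 0 < k by exact: lt_trans k_gt1.
have sq_ge0 g h : 0 <= sqdist_n x g h :> R.
  rewrite /sqdist_n /sqnorm_n; apply: mulr_ge0; first by rewrite invr_ge0 ltW.
  by apply: sumr_ge0 => i _; exact: sqr_ge0.
have msq : measurable_fun setT (fun l => sqdist_n x (F l) f).
  apply: measurable_funM => //; apply: measurable_sum => i.
  by apply: measurable_funX; exact: measurable_funB.
have risk_ge0 : (0 <= \int[p]_l (sqdist_n x (F l) f)%:E)%E.
  by apply: integral_ge0 => l _; rewrite lee_fin.
have [KLoo|KLoo] := eqVneq (KL p pi) +oo%E.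
  rewrite KLoo gt0_muley ?lte_fin// gt0_mulye ?lte_fin ?invr_gt0 ?ltr0n//.
  by rewrite addey ?leey// -ltNye (lt_le_trans _ risk_ge0).
have KLfin : KL p pi \is a fin_num by rewrite fin_numE KL_neqNy KLoo.
have [riskoo|] := eqVneq (\int[p]_l (sqdist_n x (F l) f)%:E)%E +oo%E.
  by rewrite riskoo -(fineK KLfin) -!EFinM leey.
rewrite -ltey => risk_lty.
have int_sq : p.-integrable setT (fun l => (sqdist_n x (F l) f)%:E).
  apply/integrableP; split; first exact/measurable_EFinP.
  by under eq_integral do rewrite gee0_abs ?lee_fin//.
pose r := residual x f F.
have mr i : measurable_fun setT (r i) by exact: measurable_residual.
have sqE l : sqdist_n x (F l) f = n%:R^-1 * \sum_i r i l ^+ 2.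
  rewrite /sqdist_n /sqnorm_n; congr (_ * _); apply: eq_bigr => i _.
  by rewrite /r /residual -sqrrN opprB.
have sumE l : \sum_i r i l ^+ 2 = n%:R * sqdist_n x (F l) f.
  by rewrite sqE mulrA mulfV ?mul1r// gt_eqF.
(* From |r| <= 1 + r^2 and the finiteness of the [p]-risk. *)
have int_r i : p.-integrable setT (fun l => (r i l)%:E).
  have h := integrableD measurableT (finite_measure_integrable_cst p 1 measurableT)
    (integrableZl measurableT n%:R int_sq).
  apply: le_integrable h => //; first exact/measurable_EFinP.
  move=> l _ /=; rewrite lee_fin -sumE [leRHS]ger0_norm; last first.
    by rewrite addr_ge0// sumr_ge0// => j _; exact: sqr_ge0.
  have : r i l ^+ 2 <= \sum_j r j l ^+ 2.
    by rewrite (bigD1 i)//= lerDl sumr_ge0// => j _; exact: sqr_ge0.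
  by rewrite -(real_normK (num_real (r i l))); have := normr_ge0 (r i l); nra.
pose risk := \int[p]_l sqdist_n x (F l) f.
have riskE : (\int[p]_l (sqdist_n x (F l) f)%:E)%E = risk%:E.
  by rewrite /risk /Rintegral fineK// integrable_fin_num.
pose b i := \int[p]_l r i l.
(* The Donsker-Varadhan minorant of [V]: beta times the [p]-mean of the exponent, minus beta times
   the divergence. It is affine in the noise, so first moments make it integrable. *)
pose ell (t : n.-tuple R) :=
  - (k * (n%:R * risk) + 2 * \sum_i tnth t i * b i) - beta * fine (KL p pi).
pose V (t : n.-tuple R) := beta * ln (partition_fun x f F pi beta k (tnth t)).
have mtnth i : measurable_fun setT (fun t : n.-tuple R => tnth t i).
  exact: measurable_tnth.
have mV : measurable_fun setT V.
  apply: measurable_funM => //; apply: measurableT_comp; first exact: measurable_ln.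
  apply: measurableT_comp => //.
  apply: (measurable_fun_fubini_tonelli_F
    (fun u : n.-tuple R * L => (expR (exponent x f F beta k (tnth u.1) u.2))%:E)).
    apply/measurable_EFinP; apply: measurableT_comp => //.
    apply: measurable_exponent_comp => // i.
    exact: (measurableT_comp (mtnth i) measurable_fst).
  by move=> u; rewrite lee_fin expR_ge0.
have ellV t : ell t <= V t.
  have int_tr := integrable_lincomb (tnth t) int_r.
  have int_q : p.-integrable setT (fun l =>
      (k * n%:R * sqdist_n x (F l) f + 2 * \sum_i tnth t i * r i l)%:E).
    have h := integrableD measurableT (integrableZl measurableT (k * n%:R) int_sq)
      (integrableZl measurableT 2 int_tr).
    by apply: eq_integrable h => // l _; rewrite -!EFinM -EFinD.
  have qE l : exponent x f F beta k (tnth t) l = - beta^-1 *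
      (k * n%:R * sqdist_n x (F l) f + 2 * \sum_i tnth t i * r i l).
    by rewrite /exponent -/r sumE; ring.
  have intE : p.-integrable setT (fun l => (exponent x f F beta k (tnth t) l)%:E).
    apply: eq_integrable (integrableZl measurableT (- beta^-1) int_q) => // l _.
    by rewrite -EFinM qE.
  have EE : \int[p]_l exponent x f F beta k (tnth t) l =
      - (k * (n%:R * risk) + 2 * \sum_i tnth t i * b i) / beta.
    under eq_Rintegral do rewrite qE.
    rewrite RintegralZl// RintegralD//; last 2 first.
    - by apply: eq_integrable (integrableZl measurableT (k * n%:R) int_sq).
    - by apply: eq_integrable (integrableZl measurableT 2 int_tr).
    rewrite (@RintegralZl _ _ _ p setT (fun l => sqdist_n x (F l) f))//.
    rewrite (@RintegralZl _ _ _ p setT (fun l => \sum_i tnth t i * r i l))//.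
    by rewrite Rintegral_lincomb// -/risk; ring.
  have := donsker_varadhan KLoo (measurable_exponent x f F_measurable beta k (tnth t))
    intE (integrable_expR_exponent x f F_measurable beta_gt0 pi (tnth t) k_gt0).
  rewrite EE /ell /V -(ler_pM2l beta_gt0); apply: le_trans.
  by rewrite le_eqVlt; apply/orP; left; apply/eqP; field; rewrite gt_eqF.
pose S (u : Omega * Omega') : n.-tuple R := [tuple xi i u.1 + zeta i u.2 | i < n].
pose K (w : Omega) : n.-tuple R := [tuple k * xi i w | i < n].
have mS : measurable_fun setT S by exact: measurable_sum_noise.
have mK : measurable_fun setT K by exact: measurable_scaled_noise.
have SK B : measurable B -> pushforward (P \x P')%E S B = pushforward P K B.
  by move=> mB; apply: (sum_noise_law xi_iid zeta_iid Omega'_enlarges B1 B2).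
have zetaC := zeta_centered (xi_integrable i1) (xi_centered i1) Omega'_enlarges zeta_iid B1.
have int_zeta i : P'.-integrable setT (fun w => (zeta i w)%:E) by have [] := zetaC i.
have zeta0 i : (\int[P']_w (zeta i w)%:E = 0)%E by have [] := zetaC i.
(* Only this constant part of [ell] survives the expectation, because the noise is centred. *)
pose c0 := - (k * (n%:R * risk)) - beta * fine (KL p pi).
have int_xik := integrable_lincomb (fun i => - (2 * k) * b i) xi_integrable.
have ellKE w : ell (K w) = c0 + \sum_i - (2 * k) * b i * xi i w.
  rewrite /ell /c0 opprD -!addrA; congr (_ + _); rewrite addrC; congr (_ + _).
  rewrite mulr_sumr -sumrN; apply: eq_bigr => i _; rewrite tnth_mktuple; ring.
have int_ellK : P.-integrable setT (fun w => (ell (K w))%:E).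
  have h := integrableD measurableT (finite_measure_integrable_cst P c0 measurableT) int_xik.
  by apply: eq_integrable h => // w _; rewrite ellKE.
have ellK0 : \int[P]_w ell (K w) = c0.
  under eq_Rintegral do rewrite ellKE.
  rewrite RintegralD//; last exact: finite_measure_integrable_cst.
  rewrite Rintegral_probability_cst Rintegral_lincomb// big1 ?addr0// => i _.
  have := xi_centered i; rewrite unlock /Rintegral => ->.
  by rewrite mulr0.
have pi_int y i : pi.-integrable setT
    (fun l => (theta x F beta pi y l * F l (x i))%:E).
  exact: pi_integrable.
pose D w := sqdist_n x (ewa x F beta pi (fun i => f (x i) + xi i w)) f.
pose mean w i := fbar F (posterior x f F_measurable pi beta (fun j => xi j w)) (x i).
have DE w : D w = n%:R^-1 * \sum_i (f (x i) - mean w i) ^+ 2.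
  rewrite /D /sqdist_n /sqnorm_n; congr (_ * _); apply: eq_bigr => i _.
  by rewrite (ewa_fbar n_gt0 f F_measurable beta_gt0 pi_int (fun j => xi j w)) -sqrrN opprB.
pose N w w' := \int[posterior x f F_measurable pi beta (fun j => xi j w)]_l
  excess x f F_measurable pi beta (fun j => xi j w) (fun i => F l (x i))
    (fun i => zeta i w').
have N_ge0 w w' : 0 <= N w w'.
  by apply: Rintegral_ge0 => l _; exact: excess_ge0.
have NE w w' : ((N w w')%:E = \int[posterior x f F_measurable pi beta (fun j => xi j w)]_l
    (excess x f F_measurable pi beta (fun j => xi j w) (fun i => F l (x i))
    (fun i => zeta i w'))%:E)%E.
  by rewrite /N /Rintegral fineK// integrable_fin_num//; exact: integrable_excess.
have N_le1 w : (\int[P']_w' (N w w')%:E <= 1)%E.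
  rewrite (eq_integral _ _ (fun w' _ => NE w w')).
  exact: (expected_excess_le1 F_measurable beta_gt0 pi_int zeta_iid
    (C1 beta beta0_le) (C2 beta beta0_le) (C3 beta beta0_le) (fun j => xi j w)).
have mN w : measurable_fun setT (fun w' => (N w w')%:E).
  rewrite (_ : (fun _ => _) = (fun w' =>
    \int[posterior x f F_measurable pi beta (fun j => xi j w)]_l
    (excess x f F_measurable pi beta (fun j => xi j w) (fun i => F l (x i))
    (fun i => zeta i w'))%:E)%E); last by apply/funext => w'; rewrite NE.
  apply: (measurable_fun_fubini_tonelli_F (fun u : Omega' * L =>
    (excess x f F_measurable pi beta (fun j => xi j w) (fun i => F u.2 (x i))
    (fun i => zeta i u.1))%:E)).
    apply/measurable_EFinP; apply: measurable_excess => i.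
      exact: (measurableT_comp (F_measurable (x i)) measurable_snd).
    exact: (measurableT_comp (measurable_funPT (zeta i)) measurable_fst).
  by move=> u; rewrite lee_fin excess_ge0.
have int_N w : P'.-integrable setT (fun w' => (N w w')%:E).
  apply/integrableP; split; first exact: mN.
  under eq_integral do rewrite gee0_abs ?lee_fin//.
  by apply: le_lt_trans (N_le1 w) _; rewrite ltry.
(* For a fixed outcome [w], [up w] majorises [V] along [zeta]. The term - beta is the -1 of ln N <=
   N - 1, to be repaid by the mean of [N] being at most 1. Integrability of [up] is claimed in [w']
   only. *)
pose u0 w := beta * ln (partition_fun x f F pi beta 1 (fun i => xi i w)) - D w - beta.
pose up w w' := (u0 w + \sum_i - 2 * (f (x i) - mean w i) * zeta i w') + beta * N w w'.
have tnthS w w' : tnth (S (w, w')) = (fun i => xi i w + zeta i w').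
  by apply/funext => i; rewrite tnth_mktuple.
have Vup w w' : V (S (w, w')) <= up w w'.
  have := ln_partition_fun_le n_gt0 x f F_measurable pi beta_gt0
    (fun i => xi i w) (fun i => zeta i w').
  move=> /(ler_wpM2l (ltW beta_gt0)); rewrite -/(N w w') -/k => h.
  rewrite /V tnthS.
  apply: (le_trans h); rewrite le_eqVlt; apply/orP; left.
  rewrite /up; have -> : \sum_i - 2 * (f (x i) - mean w i) * zeta i w' =
      - (2 * \sum_i zeta i w' * (f (x i) - mean w i)).
    by rewrite mulr_sumr -sumrN; apply: eq_bigr => i _; ring.
  apply/eqP; rewrite /u0 DE /mean; field; by rewrite !gt_eqF.
have int_lin w := integrable_lincomb (fun i => - 2 * (f (x i) - mean w i)) int_zeta.
have int_up0 w : P'.-integrable setT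
    (fun w' => (u0 w + \sum_i - 2 * (f (x i) - mean w i) * zeta i w')%:E).
  have h := integrableD measurableT
    (finite_measure_integrable_cst P' (u0 w) measurableT) (int_lin w).
  by apply: eq_integrable h.
have int_bN w : P'.-integrable setT (fun w' => (beta * N w w')%:E).
  by apply: eq_integrable (integrableZl measurableT beta (int_N w)).
have int_up w : P'.-integrable setT (fun w' => (up w w')%:E).
  by apply: eq_integrable (integrableD measurableT (int_up0 w) (int_bN w)).
have mVS w : measurable_fun setT (fun w' => V (S (w, w'))).
  by apply: (measurableT_comp mV); apply: (measurableT_comp mS).
have int_ellS w : P'.-integrable setT (fun w' => (ell (S (w, w')))%:E).
  pose c1 := ell [tuple xi i w | i < n].
  have h := integrableD measurableT
    (finite_measure_integrable_cst P' c1 measurableT)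
    (integrable_lincomb (fun i => - 2 * b i) int_zeta).
  apply: eq_integrable h => // w' _; rewrite /= -EFinD; congr EFin.
  rewrite /c1 /ell tnthS.
  have -> : \sum_i (xi i w + zeta i w') * b i =
    \sum_i tnth [tuple xi i0 w | i0 < n] i * b i + \sum_i zeta i w' * b i.
    by rewrite -big_split; apply: eq_bigr => i _; rewrite tnth_mktuple mulrDl.
  have -> : \sum_i - 2 * b i * zeta i w' = - (2 * \sum_i zeta i w' * b i).
    by rewrite mulr_sumr -sumrN; apply: eq_bigr => i _; ring.
  ring.
have int_V w : P'.-integrable setT (fun w' => (V (S (w, w')))%:E).
  have h := integrableD measurableT (integrable_norm (int_ellS w))
    (integrable_norm (int_up w)).
  have mVSE : measurable_fun setT (fun w' => (V (S (w, w')))%:E).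
    by apply/measurable_EFinP; exact: mVS.
  apply: (le_integrable measurableT mVSE _ h).
  move=> w' _; rewrite /= lee_fin [leRHS]ger0_norm ?addr_ge0//.
  exact: norm_le_sandwich.
have kK w : k * ln (partition_fun x f F pi beta 1 (fun i => xi i w)) <=
    ln (partition_fun x f F pi beta k (tnth (K w))).
  have -> : tnth (K w) = (fun i => k * xi i w).
    by apply/funext => i; rewrite tnth_mktuple.
  have int1 := integrable_expR_exponent x f F_measurable beta_gt0 pi (fun i => xi i w) ltr01.
  have intk := integrable_expR_exponent x f F_measurable beta_gt0 pi
    (fun i => k * xi i w) k_gt0.
  rewrite /partition_fun; under [in leRHS]eq_Rintegral do rewrite exponentZ.
  apply: lyapunov_ln_expR => //; first exact: ltW.
  by apply: eq_integrable intk => // l _; rewrite exponentZ.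
(* In the mean over [zeta] the linear term of [up] vanishes and beta N is absorbed by the - beta in
   [u0]. This leaves beta ln (Z 1 xi) - D, and [kK] replaces the first term by V (K w) / k. *)
have DV w : (\int[P']_w' (V (S (w, w')))%:E <= (k^-1 * V (K w) - D w)%:E)%E.
  apply: (@le_trans _ _ (\int[P']_w' (up w w')%:E)%E).
    by apply: le_integral => // w' _; rewrite lee_fin.
  under eq_integral do rewrite EFinD.
  rewrite integralD// -[X in (X + _)%E]fineK ?integrable_fin_num//.
  rewrite -/(Rintegral P' setT _).
  rewrite (RintegralD measurableT
    (finite_measure_integrable_cst P' (u0 w) measurableT) (int_lin w)).
  rewrite Rintegral_probability_cst Rintegral_lincomb// big1 ?addr0; last first.
    by move=> i _; rewrite /Rintegral zeta0 mulr0.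
  under eq_integral do rewrite EFinM.
  rewrite integralZl//.
  have := N_le1 w; have := integrable_fin_num measurableT (int_N w).
  case: (\int[P']_w' (N w w')%:E)%E => // q _; rewrite lee_fin => q1.
  rewrite -EFinM -EFinD lee_fin /u0.
  have : beta * q <= beta by rewrite -[leRHS]mulr1 ler_pM2l.
  have : beta * ln (partition_fun x f F pi beta 1 (fun i => xi i w)) <= k^-1 * V (K w).
    by rewrite ler_pdivlMl// /V mulrCA ler_pM2l.
  lra.
have ki_gt0 : 0 < k^-1 by rewrite invr_gt0.
have ki_lt1 : k^-1 < 1 by rewrite invf_lt1.
have h := descent mS mK SK mV ellV ki_gt0 ki_lt1 int_ellK int_V
  (fun w => sq_ge0 _ _) DV.
rewrite ellK0 in h.
rewrite unlock; apply: (le_trans h).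
(* Both constants come from k = 1 + 1/n: the divergence is multiplied by 1 - 1/k = 1 / (n + 1), and
   the risk of [p] by (1 - 1/k) k n = 1. *)
rewrite riskE -(fineK KLfin) -!EFinM -EFinD lee_fin le_eqVlt; apply/orP; left.
apply/eqP; rewrite /c0 -natr1 /k; field.
by rewrite !gt_eqF//; nra.
Qed.
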